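(* Let $n\ge 7$ and $t\ge 1$. Among all graphs in $Cact(n;t)$, the cactus with the second-minimum degree resistance distance is $G_5$. That is, $D_R(G^0(n;t))<D_R(G_5)$, and every $G\in Cact(n;t)$ that is isomorphic neither to $G^0(n;t)$ (the graph of minimum degree resistance distance in $Cact(n;t)$) nor to $G_5$ satisfies $D_R(G)>D_R(G_5)$.
   Context: All graphs are finite and simple. A cactus is a graph in which every block is either an edge or a cycle. $Cact(n;t)$ is the set of connected cacti with $n$ vertices and $t$ cycles. For a connected graph $G$, $R_G(u,v)$ is the resistance distance between $u$ and $v$, i.e. the effective resistance between $u$ and $v$ when every edge of $G$ is replaced by a unit resistor, and $d_G(u)$ is the degree of $u$. The degree resistance distance is $$D_R(G)=\sum_{\{u,v\}\subseteq V(G)}[d_G(u)+d_G(v)]\,R_G(u,v).$$ $G^0(n;t)$ is the graph on $n$ vertices consisting of $t$ triangles and $n-2t-1$ pendent edges, all sharing exactly one common vertex $v_1$. $G_5$ is the graph on $n$ vertices consisting of one 4-cycle $C_4$, $t-1$ triangles and $n-2t-2$ pendent edges, all sharing exactly one common vertex $v_1$. (Equivalently, in $G^0(n;t)$, one triangle together with one pendent edge at $v_1$ is replaced by a 4-cycle through $v_1$.) *)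

(* Defs.v *)
From mathcomp Require Import all_boot all_order all_algebra.

Set Implicit Arguments.
Unset Strict Implicit.
Unset Printing Implicit Defensive.

Import Order.TTheory GRing.Theory Num.Theory.

Record sgraph (V : finType) := SGraph {
  adj :> rel V;
  adj_sym : symmetric adj;
  adj_irr : irreflexive adj }.

Section MkGraph.
Variables (V : finType) (r : rel V).

Definition simple_closure : rel V := [rel x y | (x != y) && (r x y || r y x)].

Lemma simple_closure_sym : symmetric simple_closure.
Proof. by move=> x y; rewrite /simple_closure /= orbC (eq_sym x). Qed.

Lemma simple_closure_irr : irreflexive simple_closure.
Proof. by move=> x; rewrite /simple_closure /= eqxx. Qed.

Definition mk_sgraph : sgraph V :=
  SGraph simple_closure_sym simple_closure_irr.
End MkGraph.

Definition isomorphic (V W : finType) (G : sgraph V) (H : sgraph W) : Prop :=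
  exists2 f : V -> W, bijective f & forall x y, H (f x) (f y) = G x y.

Section Graphs.
Variables (V : finType) (G : sgraph V).

Definition deg (x : V) : nat := #|[set y | G x y]|.

Definition induced (B : {set V}) : rel V :=
  [rel x y | [&& x \in B, y \in B & G x y]].

(* The empty set counts as connected. *)
Definition connected_in (B : {set V}) : bool :=
  [forall x in B, forall y in B, connect (induced B) x y].

Definition connected : bool := connected_in [set: V].

Definition edges : {set {set V}} := [set [set p.1; p.2] | p : V * V & G p.1 p.2].

Definition edges_in (B : {set V}) : {set {set V}} :=
  [set e in edges | e \subset B].

Definition nonseparable (B : {set V}) : bool :=
  [&& B != set0, connected_in B & [forall x in B, connected_in (B :\ x)]].

(* A maximal nonseparable subgraph is induced by its vertex set, so blocks are
   represented by their vertex sets. *)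
Definition is_block (B : {set V}) : bool := maxset nonseparable B.

(* The pair (B, E) of a vertex set and an edge set is a cycle
   x_0 x_1 ... x_(k-1) x_0 with k >= 3 distinct vertices; such a k is at most
   #|V|, which makes the predicate decidable. *)
Definition is_cycle (B : {set V}) (E : {set {set V}}) : bool :=
  [exists k : 'I_#|V|.+1, exists s : k.-tuple V,
    [&& 2 < k, uniq s, B == [set x in s] &
        E == [set [set x; next s x] | x in s]]].

Definition is_edge_block (B : {set V}) : bool :=
  [exists x, exists y, G x y && (B == [set x; y])].

Definition is_cactus : bool :=
  [forall B, is_block B ==> is_edge_block B || is_cycle B (edges_in B)].

Definition cycles : {set {set V} * {set {set V}}} :=
  [set H | is_cycle H.1 H.2 && (H.2 \subset edges)].

Definition Cact (n t : nat) : Prop :=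
  [/\ #|V| = n, connected, is_cactus & #|cycles| = t].
End Graphs.

(* Vertex 0 is the common vertex; the triangles are {0, 2i+1, 2i+2} for i < t,
   and the remaining vertices are pendent.  Meaningful for 2t+1 <= n. *)
Definition G0 (n t : nat) : sgraph 'I_n :=
  mk_sgraph [rel x y : 'I_n |
    (x == 0 :> nat) || [&& odd x, y == x.+1 :> nat & y <= t.*2]].

(* Vertex 0 is the common vertex; the 4-cycle is 0 1 2 3, the triangles are
   {0, 2i+4, 2i+5} for i < t-1, and the remaining vertices are pendent.
   Meaningful for 1 <= t and 2t+2 <= n. *)
Definition G5 (n t : nat) : sgraph 'I_n :=
  mk_sgraph [rel x y : 'I_n |
    [|| (x == 0 :> nat) && (y != 2 :> nat),
        (x == 1 :> nat) && (y == 2 :> nat),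
        (x == 2 :> nat) && (y == 3 :> nat) |
        [&& 4 <= x, ~~ odd x, y == x.+1 :> nat & y <= t.*2.+1]]].

Local Open Scope ring_scope.

Section Resistance.
Variables (R : realFieldType) (V : finType) (G : sgraph V).

(* Kirchhoff's current law and Ohm's law with unit resistors: the potential phi
   carries a unit current entering the network at u and leaving it at v. *)
Definition unit_potential (u v : V) (phi : V -> R) : Prop :=
  forall x, \sum_(y | G x y) (phi x - phi y) = (x == u)%:R - (x == v)%:R.

Definition laplacian : 'M[R]_#|V| :=
  \matrix_(i, j) ((deg G (enum_val i))%:R *+ (i == j)
                  - (G (enum_val i) (enum_val j))%:R).

(* A solution of unit_potential u v whenever there is one. *)
Definition potential (u v : V) : V -> R := fun x =>
  ((delta_mx 0 (enum_rank u) - delta_mx 0 (enum_rank v) : 'rV[R]_#|V|)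
     *m pinvmx laplacian) 0 (enum_rank x).

Definition resistance (u v : V) : R := potential u v u - potential u v v.

(* The order on enum_rank selects each unordered pair {u, v} once. *)
Definition DR : R :=
  \sum_(u : V) \sum_(v : V | (enum_rank u < enum_rank v)%N)
    (deg G u + deg G v)%:R * resistance u v.

Lemma laplacianE (phi : V -> R) (x : V) :
  ((\row_i phi (enum_val i)) *m laplacian) 0 (enum_rank x) =
  \sum_(y | G x y) (phi x - phi y).
Proof.
rewrite !mxE.
under eq_bigr => i _ do rewrite !mxE mulrBr.
rewrite sumrB (bigD1 (enum_rank x)) //= big1 => [|i /negPf ->]; last first.
  by rewrite mulr0n mulr0.
rewrite eqxx enum_rankK addr0 mulr1n sumrB; congr (_ - _).
  by rewrite sumr_const /deg cardsE mulr_natr; congr (_ *+ _); apply: eq_card.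
rewrite (reindex enum_rank) /=; last first.
  by exists enum_val => ? _; [apply: enum_rankK | apply: enum_valK].
rewrite [RHS]big_mkcond /=. apply: eq_bigr => y _.
by rewrite !enum_rankK adj_sym; case: (G x y); rewrite (mulr1, mulr0).
Qed.

Lemma laplacian_tr : laplacian^T = laplacian.
Proof.
apply/matrixP=> i j; rewrite !mxE adj_sym eq_sym.
by case: eqP => [->|] //.
Qed.

Lemma harmonic_const (phi : V -> R) : connected G ->
  (forall x, \sum_(y | G x y) (phi x - phi y) = 0) ->
  forall x y, phi x = phi y.
Proof.
move=> conG harm.
pose S := \sum_x \sum_(y | G x y) (phi x - phi y) ^+ 2.
have S0 : S = 0.
  have E1 : \sum_x \sum_(y | G x y) phi x * (phi x - phi y) = 0.
    by apply: big1 => x _; rewrite -mulr_sumr harm mulr0.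
  have E2 : \sum_x \sum_(y | G x y) phi y * (phi x - phi y) = 0.
    rewrite (exchange_big_dep xpredT) //=; apply: big1 => y _.
    rewrite -mulr_sumr -[X in _ * X]opprK -sumrN.
    under eq_bigr => x _ do rewrite opprB.
    by under eq_bigl => x do rewrite adj_sym; rewrite harm oppr0 mulr0.
  transitivity (\sum_x \sum_(y | G x y) phi x * (phi x - phi y) -
                \sum_x \sum_(y | G x y) phi y * (phi x - phi y)); last first.
    by rewrite E1 E2 subrr.
  rewrite /S -sumrB; apply: eq_bigr => x _.
  by rewrite -sumrB; apply: eq_bigr => y _; rewrite -mulrBl expr2.
have adj_eq x y : G x y -> phi x = phi y.
  move=> Gxy; apply/eqP; rewrite -subr_eq0 -sqrf_eq0; apply/eqP.
  have Sx : \sum_(y | G x y) (phi x - phi y) ^+ 2 = 0.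
    apply: (psumr_eq0P _ S0) => // z _.
    by apply: sumr_ge0 => w _; apply: sqr_ge0.
  by apply: (psumr_eq0P _ Sx) => // z _; apply: sqr_ge0.
move=> x y; have /forall_inP/(_ x (in_setT _))/forall_inP/(_ y (in_setT _)) := conG.
move=> /connectP[p]; elim: p x => [|z p IH] x /=; first by move=> _ ->.
by move=> /andP[/and3P[_ _ /adj_eq ->]]; apply: IH.
Qed.

Lemma potentialP (u v : V) : connected G -> unit_potential u v (potential u v).
Proof.
move=> conG x; rewrite -laplacianE.
set b := (delta_mx 0 (enum_rank u) - delta_mx 0 (enum_rank v) : 'rV[R]_#|V|).
have -> : \row_i potential u v (enum_val i) = b *m pinvmx laplacian.
  by apply/rowP=> i; rewrite mxE /potential enum_valK.
rewrite mulmxKpV; first by rewrite !mxE !eqxx !(inj_eq enum_rank_inj).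
rewrite submxE; have := mulmx_coker laplacian.
move: (cokermx laplacian) => K LK; apply/eqP/rowP=> j; rewrite mulmxBl -!rowE !mxE.
apply/eqP; rewrite subr_eq0; apply/eqP.
pose phi y : R := K (enum_rank y) j.
apply: (harmonic_const (phi := phi)) => // y; rewrite -laplacianE.
have -> : \row_i phi (enum_val i) = (col j K)^T.
  by apply/rowP=> i; rewrite !mxE /phi enum_valK.
by rewrite -laplacian_tr -trmx_mul colE mulmxA LK mul0mx trmx0 mxE.
Qed.

Lemma resistanceP (u v : V) (phi : V -> R) : connected G ->
  unit_potential u v phi -> resistance u v = phi u - phi v.
Proof.
move=> conG phiP; have potP := potentialP u v conG.
have subBB (a b c e : R) : (a - b) - (c - e) = (a - c) - (b - e).
  by rewrite !opprB addrACA [RHS]addrACA (addrC (- b)).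
have dE : phi u - potential u v u = phi v - potential u v v.
  apply: (harmonic_const (phi := fun x => phi x - potential u v x)) => // x.
  under eq_bigr => y _ do rewrite subBB.
  by rewrite sumrB phiP potP subrr.
by apply/eqP; rewrite /resistance eq_sym -subr_eq0 subBB dE subrr.
Qed.
End Resistance.

(* Main.v *)
Require Import Defs.
From mathcomp Require Import all_boot all_order all_algebra.
From mathcomp Require Import zify ring lra.

Set Implicit Arguments.
Unset Strict Implicit.
Unset Printing Implicit Defensive.

Import Order.TTheory GRing.Theory Num.Theory.

(**
For a block B, every vertex v has a unique projection onto B: the vertex of B reached from v
without using the edges of B. Resistances add up over the blocks, R(u,v) being the sum over B of
the resistance inside B between the projections of u and v, so D_R is a sum over blocks of
  sum_(a, b in B) r_B(a,b) D_a N_b,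
with N_b the number of vertices and D_a the sum of the degrees in the fibers of the projection.
For a block with k vertices, given n and t, this is at least an explicit value depending on k
only, with equality exactly when all fibers but one are trivial. Comparing a k-cycle with a
triangle and k-3 pendent edges, the excess over the bouquet of triangles and edges is 0 for
k = 2, 3, is gap = (5n+t-31)/3 for k = 4 and larger than gap for k >= 5, while a block with two
nontrivial fibers costs more than gap when k = 2, 3. So a cactus within gap of the minimum has
only blocks with at most four vertices and one nontrivial fiber, and at most one 4-cycle; its
blocks then share a vertex, and it is G0 or G5.
*)

(** The lower bound depends on k alone because an edge or a cycle looks the same from each of its
    vertices: all rows of r_B have the same sum, and all vertices of B have the same degree d inside
    B. Write D_a = d + D'_a and N_b = 1 + N'_b. In the expansion, everything except the sum of
    r_B(a,b) D'_a N'_b is a row sum times a total known from n, t and k ([contribE]). The remaining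
    sum, [cross], is nonnegative and vanishes when only one fiber is nontrivial, since r_B(c,c) = 0.
    With two nontrivial fibers, 2 N'_a <= D'_a and r_B >= 1/2 off the diagonal bound it from below.
    The tree of blocks and cut vertices is never built: for distinct x and u, exactly one block at x
    has u projecting away from x ([card_separating_blocks]), and double counting over that block
    replaces induction on the tree. *)

Lemma card_set_sum (T : finType) (P : pred T) : #|[set x | P x]| = \sum_x (P x : nat).
Proof. by rewrite -sum1dep_card big_mkcond; apply: eq_bigr => x _; case: (P x). Qed.

(** * Blocks and projections *)

Section Blocks.
Variables (V : finType) (G : sgraph V).
Implicit Types (A B : {set V}) (x y z u v : V).

Lemma adj_neq x y : G x y -> x != y.
Proof. by apply: contraTneq => ->; rewrite adj_irr. Qed.

Lemma induced_sym B : symmetric (induced G B).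
Proof. by move=> x y; rewrite /induced /= adj_sym andbCA. Qed.

Lemma connect_induced_sym B : connect_sym (induced G B).
Proof. exact: (sym_connect_sym (@induced_sym B)). Qed.

Lemma connect_inducedS A B : A \subset B ->
  subrel (connect (induced G A)) (connect (induced G B)).
Proof.
move=> /subsetP sAB; apply: connect_sub => x y /and3P[xA yA Gxy].
by apply: connect1; rewrite /induced /= !sAB.
Qed.

Lemma connected_inP B :
  reflect {in B &, forall x y, connect (induced G B) x y} (connected_in G B).
Proof.
apply: (iffP forall_inP) => [h x y xB yB|h x xB].
  by have /forall_inP := h x xB; apply.
by apply/forall_inP=> y yB; apply: h.
Qed.

Lemma connected_in_star B x :
  (forall y, y \in B -> connect (induced G B) x y) -> connected_in G B.
Proof.
move=> h; apply/connected_inP=> y z yB zB.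
by apply: connect_trans (h z zB); rewrite connect_induced_sym h.
Qed.

Lemma connected_inU A B z : connected_in G A -> connected_in G B ->
  z \in A -> z \in B -> connected_in G (A :|: B).
Proof.
move=> /connected_inP cA /connected_inP cB zA zB.
apply: (@connected_in_star _ z) => y; rewrite inE => /orP[yA|yB].
  by apply: connect_inducedS (cA _ _ zA yA); apply: subsetUl.
by apply: connect_inducedS (cB _ _ zB yB); apply: subsetUr.
Qed.

Lemma path_connected_in x p : path G x p -> connected_in G [set z in x :: p].
Proof.
elim: p x => [|y p IH] x /=.
  move=> _; apply: (@connected_in_star _ x) => z; rewrite !inE => /eqP->.
  exact: connect0.
move=> /andP[Gxy /IH cp].
have -> : [set z in [:: x, y & p]] = [set x; y] :|: [set z in y :: p].
  by apply/setP=> z; rewrite !inE; do !case: (_ == _).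
apply: (@connected_inU _ _ y) => //; rewrite ?inE ?eqxx ?orbT //.
apply: (@connected_in_star _ x) => z; rewrite !inE => /orP[]/eqP->.
  exact: connect0.
by apply: connect1; rewrite /induced /= !inE !eqxx orbT.
Qed.

Lemma nonseparable_connected B : nonseparable G B -> connected_in G B.
Proof. by case/and3P. Qed.

Lemma nonseparableD1 B x : nonseparable G B -> connected_in G (B :\ x).
Proof.
case/and3P=> _ cB /forall_inP h; have [/h //|xB] := boolP (x \in B).
by rewrite (setDidPl _) // disjoint_sym disjoints1.
Qed.

(** Whichever vertex is deleted, [x] or [y] survives and joins the two remainders. Hence distinct
    blocks share at most one vertex. *)
Lemma nonseparableU A B x y : nonseparable G A -> nonseparable G B ->
  x != y -> x \in A -> x \in B -> y \in A -> y \in B -> nonseparable G (A :|: B).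
Proof.
move=> nA nB xy xA xB yA yB; apply/and3P; split.
- by apply/set0Pn; exists x; rewrite inE xA.
- exact: (connected_inU (nonseparable_connected nA) (nonseparable_connected nB) xA xB).
apply/forall_inP=> z _; rewrite setDUl.
have [zx|zx] := eqVneq z x.
  by apply: (@connected_inU _ _ y); rewrite ?nonseparableD1 // !inE zx eq_sym xy.
by apply: (@connected_inU _ _ x); rewrite ?nonseparableD1 // !inE eq_sym zx.
Qed.

(** Rotating the deleted vertex to the front leaves a path. Two vertices are allowed, so an edge
    counts as a cycle here. *)
Lemma cycle_nonseparable (s : seq V) : s != [::] -> uniq s -> cycle G s ->
  nonseparable G [set x in s].
Proof.
case: s => // x p _ us cs.
have cpx y q : cycle G (y :: q) -> path G y q.
  by rewrite /= rcons_path => /andP[].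
apply/and3P; split.
- by apply/set0Pn; exists x; rewrite !inE eqxx.
- exact: path_connected_in (cpx _ _ cs).
apply/forall_inP=> y; rewrite inE => ys.
have [i q eq_rot] := rot_to ys.
have uq : uniq (y :: q) by rewrite -eq_rot rot_uniq.
have cq : cycle G (y :: q) by rewrite -eq_rot rot_cycle.
have -> : [set z in x :: p] :\ y = [set z in q].
  apply/setP=> z; rewrite !inE -in_cons -(mem_rot i) eq_rot inE.
  by case: eqVneq => //= ->; case/andP: uq => /negPf->.
case: q cq {eq_rot uq} => [|w q] cq.
  by apply/connected_inP=> a b; rewrite inE.
by have /= /andP[_ /path_connected_in] := cpx _ _ cq.
Qed.

Lemma edge_nonseparable x y : G x y -> nonseparable G [set x; y].
Proof.
move=> Gxy; have -> : [set x; y] = [set z in [:: x; y]].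
  by apply/setP=> z; rewrite !inE.
by apply: cycle_nonseparable; rewrite //= ?inE ?adj_neq //= Gxy adj_sym Gxy.
Qed.

Lemma block_nonseparable B : is_block G B -> nonseparable G B.
Proof. by case/maxsetP. Qed.

Lemma block_max A B : is_block G B -> nonseparable G A -> B \subset A -> A = B.
Proof. by case/maxsetP=> _; apply. Qed.

Lemma nonseparable_sub_block A : nonseparable G A ->
  exists2 B, is_block G B & A \subset B.
Proof. by move=> /(@maxset_exists _ (nonseparable G)) [B bB sAB]; exists B. Qed.

Lemma edge_block x y : G x y ->
  exists B, [/\ is_block G B, x \in B & y \in B].
Proof.
move=> /edge_nonseparable/nonseparable_sub_block[B bB /subsetP sB].
by exists B; rewrite !sB // !inE eqxx ?orbT.
Qed.

Lemma block_inter B B' x y : is_block G B -> is_block G B' -> x != y ->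
  x \in B -> x \in B' -> y \in B -> y \in B' -> B = B'.
Proof.
move=> bB bB' xy xB xB' yB yB'.
have nU := nonseparableU (block_nonseparable bB) (block_nonseparable bB')
  xy xB xB' yB yB'.
by rewrite -(block_max bB nU (subsetUl _ _)) -[RHS](block_max bB' nU (subsetUr _ _)).
Qed.

Definition off_block B : rel V := [rel x y | G x y && ~~ ((x \in B) && (y \in B))].

Lemma off_block_sym B : connect_sym (off_block B).
Proof.
apply: sym_connect_sym => x y.
by rewrite /off_block /= adj_sym [(x \in B) && _]andbC.
Qed.

(** [b] is the first vertex of [B] on the path, so no edge before it lies inside [B]. Its membership
    in the path serves [proj_avoid]. *)
Lemma path_hits_block B v p : path G v p -> last v p \in B ->
  exists b, [/\ b \in B, b \in v :: p & connect (off_block B) v b].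
Proof.
elim: p v => [|y p IH] v /=; first by exists v; rewrite inE eqxx.
move=> /andP[Gvy /IH{}IH] /IH[b [bB bp cb]].
have [vB|vB] := boolP (v \in B); first by exists v; rewrite inE eqxx.
exists b; rewrite inE bp orbT; split=> //; apply: connect_trans cb.
by apply: connect1; rewrite /off_block /= Gvy (negPf vB).
Qed.

(* Otherwise an ear of B, closed up inside B, is a cycle whose union with B is nonseparable. *)
Lemma off_block_inj B b b' : is_block G B -> b \in B -> b' \in B ->
  connect (off_block B) b b' -> b = b'.
Proof.
move=> bB bB0 bB1 /connectP[p0 /shortenP[p pp up _ {p0}] eb'].
case: p pp up eb' => [|y p] // pp; rewrite cons_uniq => /andP[bp up] /= eb'; exfalso.
have hB : has (mem B) (y :: p) by apply/hasP; exists b'; rewrite // eb' mem_last.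
(* [b1] is the first return to [B], so the interior [q1] of the ear avoids [B]. *)
case: (split_find hB) pp bp up => b1 q1 q2 b1B nh.
rewrite cat_path rcons_path -andbA mem_cat mem_rcons inE !negb_or cat_uniq rcons_uniq.
move=> /and3P[pq1 pb1 _] /andP[/andP[bb1 bq1] _] /andP[/andP[b1q1 uq1] _].
have nq1 z : z \in q1 -> z \notin B by move=> zq; apply: contra nh => zB; apply/hasP; exists z.
have /connected_inP/(_ _ _ b1B bB0)/connectP :=
  nonseparable_connected (block_nonseparable bB).
case=> q0 /shortenP[q pq uq _ {q0}] eb.
have qB z : z \in q -> z \in B.
  move=> zq; move: pq; case/splitPr: zq => q3 q4.
  by rewrite cat_path /= => /and3P[_ /and3P[]].
have offG : subrel (off_block B) G by move=> c d /andP[].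
have indG : subrel (induced G B) G by move=> c d /and3P[].
pose s := b1 :: q ++ q1.
have cs : cycle G s.
  rewrite /s /= rcons_path cat_path (sub_path indG pq) -eb (sub_path offG pq1).
  by rewrite last_cat -eb; case/andP: pb1.
have us : uniq s.
  move: uq => /= /andP[b1q uq]; rewrite /= mem_cat negb_or b1q b1q1 cat_uniq uq uq1.
  rewrite !andbT /=; apply/hasP=> -[z /nq1 zB zq].
  by rewrite qB in zB.
have bs : b \in s by rewrite eb /s -cat_cons mem_cat mem_last.
have nU := @nonseparableU _ B b b1 (@cycle_nonseparable s isT us cs)
  (block_nonseparable bB) bb1.
have {nU} : [set x in s] :|: B = B.
  by apply: block_max (subsetUr _ _) => //; apply: nU; rewrite ?inE ?eqxx.
move/setP => eU; have q1B z : z \in q1 -> z \in B.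
  by move=> zq; rewrite -eU !inE mem_cat zq !orbT.
(* Maximality puts [q1] inside [B]. So [q1] is empty, and then the edge from [b] to [b1] has both
   ends in [B], which [off_block] forbids. *)
case: q1 q1B nq1 pb1 {eU pq1 nh bq1 b1q1 uq1 cs us bs s} => [|z q1] q1B nq1 pb1.
  by move: pb1; rewrite /off_block /= bB0 (b1B : b1 \in B) andbF.
by have := nq1 z; rewrite q1B inE eqxx => // /(_ isT).
Qed.

Hypothesis conG : connected G.

Lemma connectedP x y : connect G x y.
Proof.
have /connected_inP/(_ x y (in_setT _) (in_setT _)) := conG.
by apply: connect_sub => a b /and3P[_ _ Gab]; apply: connect1.
Qed.

(** The default [v] is never reached for a block of a connected graph, by [projP]; the picked vertex
    is unique by [off_block_inj]. *)
Definition proj B v := odflt v [pick b in B | connect (off_block B) v b].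

Lemma block_neq0 B : is_block G B -> B != set0.
Proof. by move/block_nonseparable/and3P=> []. Qed.

Lemma projP B v : is_block G B ->
  (proj B v \in B) && connect (off_block B) v (proj B v).
Proof.
move=> bB; rewrite /proj; case: pickP => [b //|noB] /=.
have /set0Pn[b0 b0B] := block_neq0 bB.
have /connectP[p pp eb0] := connectedP v b0.
rewrite eb0 in b0B.
by have [b [bB' _ cb]] := path_hits_block pp b0B; have := noB b; rewrite bB' cb.
Qed.

Lemma proj_in B v : is_block G B -> proj B v \in B.
Proof. by move=> /(projP v)/andP[]. Qed.

Lemma proj_uniq B v b : is_block G B -> b \in B -> connect (off_block B) v b ->
  proj B v = b.
Proof.
move=> bB b0 cb; have /andP[pB cp] := projP v bB.
apply: (off_block_inj bB) => //; apply: connect_trans cb.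
by rewrite off_block_sym.
Qed.

Lemma proj_id B b : is_block G B -> b \in B -> proj B b = b.
Proof. by move=> bB b0; apply: proj_uniq. Qed.

Lemma proj_connect B u v : is_block G B -> connect (off_block B) u v ->
  proj B u = proj B v.
Proof.
move=> bB cuv; have /andP[pB cp] := projP v bB.
by apply: proj_uniq => //; apply: connect_trans cp.
Qed.

Lemma proj_edge B x y : is_block G B -> G x y -> ~~ ((x \in B) && (y \in B)) ->
  proj B x = proj B y.
Proof.
by move=> bB Gxy nxy; apply: proj_connect => //; apply/connect1/andP.
Qed.

Lemma proj_block B B' x y : is_block G B -> is_block G B' -> B != B' ->
  x \in B' -> y \in B' -> proj B x = proj B y.
Proof.
move=> bB bB' nB xB' yB'; apply: proj_connect => //.
have /connected_inP/(_ _ _ xB' yB') := nonseparable_connected (block_nonseparable bB').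
apply: connect_sub => a b /and3P[aB' bB'0 Gab]; apply: connect1.
rewrite /off_block /= Gab; apply: contra nB => /andP[aB bB0].
by rewrite (block_inter bB bB' (adj_neq Gab)).
Qed.

(** The projection is the first vertex of [B] on any path to [B], so it lies on a path that avoids
    [x]. *)
Lemma proj_avoid B x u b : is_block G B -> b \in B -> u != x ->
  connect (induced G [set~ x]) u b -> proj B u != x.
Proof.
move=> bB b0 nux /connectP[p pp eb].
have pG : path G u p by apply: sub_path pp => c d /and3P[].
have lB : last u p \in B by rewrite -eb.
have [b1 [b1B b1p /(proj_uniq bB b1B) ->]] := path_hits_block pG lB.
move: b1p; rewrite inE => /orP[/eqP->//|b1p].
move: pp; case/splitPr: b1p => p1 p2.
by rewrite cat_path /= => /and3P[_ /and3P[_]]; rewrite !inE.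
Qed.

(** Every vertex on an off-block path to the projection has that same projection; [x], lying in [B],
    would be its own. *)
Lemma proj_neq_connect B x u : is_block G B -> x \in B -> proj B u != x ->
  connect (induced G [set~ x]) u (proj B u).
Proof.
move=> bB xB nx; have /andP[pB /connectP[p]] := projP u bB.
move: (proj B u) nx pB => b nx b0.
elim: p u => [|y p IH] u /=; first by move=> _ ->; apply: connect0.
move=> /andP[ouy py] eb.
have onx z : connect (off_block B) z b -> z != x.
  move=> czb; apply: contraNneq nx => ezx; rewrite ezx in czb.
  by rewrite (off_block_inj bB xB b0 czb).
have cyb : connect (off_block B) y b by apply/connectP; exists p.
have cub : connect (off_block B) u b by apply: connect_trans (connect1 ouy) cyb.
apply: connect_trans (IH y py eb); apply: connect1.
by rewrite /induced /= !inE !onx //; case/andP: ouy.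
Qed.

Lemma proj_separating_block x u : u != x ->
  exists2 B, is_block G B & (x \in B) && (proj B u != x).
Proof.
move=> nux; have /connectP[p0 /shortenP[p pp up _ {p0}] eu] := connectedP x u.
case: p pp up eu => [|y p]; first by move=> _ _ /= eu; rewrite eu eqxx in nux.
rewrite cons_uniq => pp /andP[xp _] /= eu.
(* The first edge of a simple path from [x] to [u] picks the block: the rest of the path avoids
   [x]. *)
case/andP: pp => Gxy pp; have [B [bB xB yB]] := edge_block Gxy.
exists B; rewrite // xB (proj_avoid bB yB nux) // connect_induced_sym eu.
apply/connectP; exists p => //; elim: p y xp pp {eu Gxy yB} => //= z p IH y.
rewrite inE negb_or => /andP[xy zp] /andP[Gyz pp].
apply/andP; split; last exact: IH.
rewrite /induced /= !inE (eq_sym y) xy Gyz andbT /=.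
by move: zp; rewrite inE negb_or eq_sym => /andP[].
Qed.

(** Both projections of [u] are joined to [u], hence to each other, by paths avoiding [x]; but a
    second block through [x] projects onto [B] at [x] as a whole. *)
Lemma proj_separating_uniq B B' x u : is_block G B -> is_block G B' ->
  x \in B -> x \in B' -> proj B u != x -> proj B' u != x -> B = B'.
Proof.
move=> bB bB' xB xB' nB nB'; apply: contraTeq isT => nBB' /=.
have c1 := proj_neq_connect bB xB nB; have c2 := proj_neq_connect bB' xB' nB'.
have c3 : connect (induced G [set~ x]) (proj B' u) (proj B u).
  by apply: connect_trans c1; rewrite connect_induced_sym.
have := proj_avoid bB (proj_in u bB) nB' c3.
rewrite (proj_block bB bB' nBB' (proj_in u bB') xB') proj_id //.
by rewrite eqxx.
Qed.

Lemma card_separating_blocks x u :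
  \sum_(B | is_block G B && (x \in B)) (proj B u != x : nat) = (u != x).
Proof.
have [->|nux] := eqVneq u x.
  by apply: big1 => B /andP[bB xB]; rewrite proj_id // eqxx.
have [B bB /andP[xB nB]] := proj_separating_block nux.
rewrite (bigD1 B) /= ?bB // nB big1 // => B' /andP[/andP[bB' xB'] nBB'].
apply/eqP; rewrite eqb0; apply: contra nBB' => nB'.
by apply/eqP; apply: proj_separating_uniq nB.
Qed.

Definition bdeg B x := #|[set y in B | G x y]|.

Lemma edge_in_unique_block x y :
  \sum_(B | is_block G B && (x \in B)) (y \in B) * G x y = G x y.
Proof.
have [Gxy|nG] := boolP (G x y); last by apply: big1 => B _; rewrite muln0.
have [B [bB xB yB]] := edge_block Gxy.
rewrite (bigD1 B) ?bB //= yB big1 // => B' /andP[/andP[bB' xB'] nBB'].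
rewrite muln1; apply/eqP; rewrite eqb0; apply: contra nBB' => yB'.
by rewrite (block_inter bB bB' (adj_neq Gxy)).
Qed.

Lemma deg_blocks x : \sum_(B | is_block G B && (x \in B)) bdeg B x = deg G x.
Proof.
rewrite /deg card_set_sum.
under [RHS]eq_bigr => y _ do rewrite -edge_in_unique_block.
rewrite exchange_big /=; apply: eq_bigr => B _.
by rewrite /bdeg card_set_sum; apply: eq_bigr => y _; rewrite mulnb.
Qed.

(** Each [x] other than [u] is charged to the block at [x] that separates it from [u]; a block [B]
    collects all its vertices except [proj B u]. *)
Lemma sum_blocks_card u : \sum_(B | is_block G B) (#|B|.-1) = #|V|.-1.
Proof.
have -> : #|V|.-1 = \sum_x (u != x : nat).
  rewrite -cardsT (cardsD1 u) inE /= -card_set_sum; apply: eq_card => x.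
  by rewrite !inE eq_sym andbT.
under [RHS]eq_bigr => x _ do rewrite -card_separating_blocks.
rewrite (exchange_big_dep (is_block G)) /=; last by move=> x B _ /andP[].
apply: eq_bigr => B bB; rewrite (cardsD1 (proj B u)) proj_in //=.
rewrite -sum1_card big_mkcond [RHS]big_mkcond; apply: eq_bigr => x _.
by rewrite !inE bB eq_sym andbC /=; case: (x \in B); case: eqP.
Qed.

End Blocks.

(** * Fibers of the projection onto a block *)

Section Fibers.
Variables (V : finType) (G : sgraph V).
Implicit Types (B : {set V}) (x y z u v : V).
Hypothesis conG : connected G.

Definition fibN B a := #|[set v | proj G B v == a]|.
Definition fibD B a := \sum_(v | proj G B v == a) deg G v.

(* At most one vertex of B is a cut vertex. *)
Definition concentrated B :=
  [exists c in B, [forall a in B, (a != c) ==> (fibN B a == 1)]].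

Lemma sum_fibN B : is_block G B -> \sum_(a in B) fibN B a = #|V|.
Proof.
move=> bB; rewrite -sum1_card [RHS](partition_big (proj G B) (mem B)) /=.
  by apply: eq_bigr => a _; rewrite sum1dep_card.
by move=> v _; apply: proj_in.
Qed.

Lemma sum_fibD B : is_block G B -> \sum_(a in B) fibD B a = \sum_v deg G v.
Proof.
move=> bB; rewrite [RHS](partition_big (proj G B) (mem B)) //= => v _.
exact: proj_in.
Qed.

Lemma fibN_gt0 B a : is_block G B -> a \in B -> 0 < fibN B a.
Proof. by move=> bB aB; apply/card_gt0P; exists a; rewrite inE proj_id. Qed.

Lemma fibDE B a : fibD B a =
  \sum_(B' | is_block G B') \sum_(u in B' | proj G B u == a) bdeg G B' u.
Proof.
rewrite /fibD; under eq_bigr => v _ do rewrite -deg_blocks.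
rewrite (exchange_big_dep (is_block G)) /=; last by move=> u B' _ /andP[].
by apply: eq_bigr => B' bB'; apply: eq_bigl => u; rewrite bB' andbC.
Qed.

(** Each [u] in the fiber other than [a] is charged to the block at [u] that separates it from [a].
    The range of summation is that of [fibDE], so the two can be compared block by block. *)
Lemma fibNE B a : is_block G B -> a \in B -> (fibN B a).-1 =
  \sum_(B' | is_block G B') \sum_(u in B' | proj G B u == a) (proj G B' a != u).
Proof.
move=> bB aB; rewrite /fibN (cardsD1 a) inE proj_id // eqxx /=.
transitivity (\sum_(u | proj G B u == a) (a != u : nat)).
  rewrite -sum1_card big_mkcond [RHS]big_mkcond; apply: eq_bigr => u _.
  by rewrite !inE eq_sym; do 2!case: eqP.
under eq_bigr => u _ do rewrite -(card_separating_blocks conG).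
rewrite (exchange_big_dep (is_block G)) /=; last by move=> u B' _ /andP[].
by apply: eq_bigr => B' bB'; apply: eq_bigl => u; rewrite bB' andbC.
Qed.

(** A block other than [B] projects to a single vertex of [B], so it lies entirely in the fiber of
    [a] or outside it. Inside, it adds |B'| - 1 to the vertex count and its degree sum to the
    degree, whence the factors 2 and 4. *)
Lemma fibD_bounds B a : is_block G B -> a \in B ->
  (forall B', is_block G B' ->
     2 * #|B'|.-1 <= \sum_(x in B') bdeg G B' x <= 4 * #|B'|.-1) ->
  bdeg G B a + 2 * (fibN B a).-1 <= fibD B a <= bdeg G B a + 4 * (fibN B a).-1.
Proof.
move=> bB aB hB; rewrite fibDE fibNE // (bigD1 B bB) /= [X in _ <= X <= _](bigD1 B bB) /=.
have -> : \sum_(u in B | proj G B u == a) bdeg G B u = bdeg G B a.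
  rewrite (big_pred1 a) // => u /=.
  apply/andP/eqP => [[uB]|->]; last by rewrite proj_id ?eqxx.
  by rewrite proj_id // => /eqP.
have -> : \sum_(u in B | proj G B u == a) (proj G B a != u) = 0.
  apply: big1 => u /andP[uB]; rewrite !proj_id // => /eqP->.
  by rewrite eqxx.
rewrite !leq_add2l !add0n !big_distrr /=.
suff h B' : is_block G B' && (B' != B) ->
    2 * \sum_(u in B' | proj G B u == a) (proj G B' a != u)
    <= \sum_(u in B' | proj G B u == a) bdeg G B' u
    <= 4 * \sum_(u in B' | proj G B u == a) (proj G B' a != u).
  by apply/andP; split; apply: leq_sum => B' /h/andP[].
move=> /andP[bB' nB]; rewrite eq_sym in nB.
have pB' := proj_in conG a bB'.
have cst u : u \in B' -> proj G B u = proj G B (proj G B' a).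
  by move=> uB'; apply: (proj_block conG bB bB').
have [eqa|neqa] := eqVneq (proj G B (proj G B' a)) a; last first.
  have e F : \sum_(u in B' | proj G B u == a) F u = 0.
    by apply: big_pred0 => u; apply/negP=> /andP[/cst-> /eqP]; apply/eqP.
  by rewrite !e.
have e F : \sum_(u in B' | proj G B u == a) F u = \sum_(u in B') F u.
  by apply: eq_bigl => u; case: (boolP (u \in B')) => //= /cst->; rewrite eqa eqxx.
rewrite !e; have -> : \sum_(u in B') (proj G B' a != u) = #|B'|.-1; last exact: hB.
rewrite (cardsD1 (proj G B' a)) pB' /= -sum1_card big_mkcond [RHS]big_mkcond /=.
by apply: eq_bigr => u _; rewrite !inE eq_sym; case: (u \in B'); case: eqP.
Qed.

End Fibers.

(** * Blocks and cycles of cacti *)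

Section CactusBlocks.
Variables (V : finType) (G : sgraph V).
Implicit Types (B : {set V}) (x y z u v : V).

Lemma set2_inj x y z w : [set x; y] = [set z; w] ->
  (x = z /\ y = w) \/ (x = w /\ y = z).
Proof.
move/setP=> e; have := e x; have := e y; have := e z; have := e w.
rewrite !inE !eqxx ?orbT /= ![z == _]eq_sym ![w == _]eq_sym.
by do !(case: eqP => //= ?; subst; auto).
Qed.

Lemma edgesE x y : ([set x; y] \in edges G) = G x y.
Proof.
apply/imsetP/idP => [[[a b]]|Gxy]; last by exists (x, y); rewrite ?inE.
by rewrite inE /= => Gab /set2_inj[[-> ->]|[-> ->]] //; rewrite adj_sym.
Qed.

Lemma edgesP e : reflect (exists x y, G x y /\ e = [set x; y]) (e \in edges G).
Proof.
apply: (iffP imsetP) => [[[a b]]|[x [y [Gxy ->]]]].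
  by rewrite inE /= => Gab ->; exists a, b.
by exists (x, y); rewrite ?inE.
Qed.

(** Since [edges_in] takes all edges spanned by [B], the cycle has no chord. The order of the list
    supplies the positions needed for resistances. *)
Definition cycle_list B (s : seq V) :=
  [/\ 2 < size s, uniq s, B = [set x in s] &
      {in s &, forall x y, G x y = (y == next s x) || (x == next s y)}].

Lemma is_cycle_list B : is_cycle B (edges_in G B) -> exists s, cycle_list B s.
Proof.
case/existsP=> k /existsP[s /and4P[k2 us /eqP eB /eqP eE]].
exists s; split; rewrite ?size_tuple // => x y xs ys.
have <- : ([set x; y] \in edges_in G B) = G x y.
  rewrite inE edgesE eB; case: (G x y) => //=; apply/subsetP=> z.
  by rewrite !inE => /orP[]/eqP->.
rewrite eE; apply/imsetP/orP => [[z zs /set2_inj[[-> ->]|[-> ->]]]|].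
- by left.
- by right.
case=> /eqP ->; first by exists x.
by exists y => //; rewrite setUC.
Qed.

Lemma cycle_list_is_cycle B s : cycle_list B s -> is_cycle B (edges_in G B).
Proof.
case=> k2 us eB adjE.
have ks : size s < #|V|.+1 by rewrite ltnS -(card_uniqP us) max_card.
apply/existsP; exists (Ordinal ks); apply/existsP; exists (in_tuple s).
rewrite k2 us eB eqxx /=; apply/eqP/setP=> e; apply/idP/imsetP.
  rewrite inE => /andP[/edgesP[x [y [Gxy ->]]] /subsetP sB].
  have xs : x \in s by have := sB x; rewrite !inE eqxx => /(_ isT).
  have ys : y \in s by have := sB y; rewrite !inE eqxx orbT => /(_ isT).
  move: Gxy; rewrite adjE // => /orP[]/eqP->; first by exists x.
  by exists y => //; rewrite setUC.
case=> x xs ->; rewrite inE edgesE adjE ?mem_next // eqxx /=.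
by apply/subsetP=> z; rewrite !inE => /orP[]/eqP->; rewrite ?mem_next.
Qed.

Lemma cactus_block B : is_cactus G -> is_block G B ->
  (exists x y, G x y /\ B = [set x; y]) \/ (exists s, cycle_list B s).
Proof.
move=> /forallP/(_ B)/implyP h /h /orP[|/is_cycle_list]; last by right.
by case/existsP=> x /existsP[y /andP[Gxy /eqP->]]; left; exists x, y.
Qed.

Lemma next_index x0 (s : seq V) i : uniq s -> i < size s ->
  next s (nth x0 s i) = nth x0 s (if i.+1 == size s then 0 else i.+1).
Proof.
case: s => // y s us i_s; rewrite next_nth mem_nth // index_uniq //= eqSS.
case: eqP => [->|ni] /=; first by rewrite nth_default.
by apply: set_nth_default; move: i_s ni => /=; lia.
Qed.

Lemma cycle_list_adj B s x0 i j : cycle_list B s -> i < size s -> j < size s ->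
  G (nth x0 s i) (nth x0 s j) =
   (j == if i.+1 == size s then 0 else i.+1) ||
   (j == if i == 0 then (size s).-1 else i.-1).
Proof.
case=> k2 us eB adjE i_s js; rewrite adjE ?mem_nth // !next_index //.
have lt l : l < size s -> (if l.+1 == size s then 0 else l.+1) < size s.
  by move=> h; case: eqP => ?; lia.
rewrite !nth_uniq ?lt //.
congr (_ || _); case: (eqVneq j.+1 (size s)) => hj; case: (eqVneq i 0) => hi;
  by apply/eqP/eqP; lia.
Qed.

Lemma big_cycle_list (R : Type) (idx : R) (op : Monoid.com_law idx) B s x0 F : cycle_list B s ->
  \big[op/idx]_(y in B) F y = \big[op/idx]_(i < size s) F (nth x0 s i).
Proof.
case=> _ us -> _; rewrite -(big_mkord xpredT (F \o nth x0 s)) -(big_nth x0 xpredT) big_uniq //=.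
by apply: eq_bigl => x; rewrite inE.
Qed.

Lemma big_cycle_nbrs (R : Type) (idx : R) (op : Monoid.com_law idx) B s x0 F i :
  cycle_list B s -> i < size s ->
  \big[op/idx]_(y in B | G (nth x0 s i) y) F y =
  op (F (nth x0 s (if i.+1 == size s then 0 else i.+1)))
     (F (nth x0 s (if i == 0 then (size s).-1 else i.-1))).
Proof.
move=> cB i_s; have [k2 us _ _] := cB.
rewrite big_mkcondr (big_cycle_list _ x0 _ cB) -big_mkcond /=.
set a := (if _ then _ else _); set b := (if _ then _ else _).
have la : a < size s by rewrite /a; case: eqP; lia.
have lb : b < size s by rewrite /b; case: eqP; lia.
have nab : b != a by rewrite /a /b; case: ifP => ?; case: ifP => ?; lia.
rewrite (bigD1 (Ordinal la)) /= ?(cycle_list_adj _ cB) ?eqxx //.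
rewrite (bigD1 (Ordinal lb)) /= ?(cycle_list_adj _ cB) ?eqxx ?orbT //.
rewrite big_pred0 ?Monoid.mulm1 // => j.
rewrite (cycle_list_adj _ cB) // -/a -/b -!val_eqE /=.
by do 2!case: (_ == _).
Qed.

Lemma card_cycle_list B s : cycle_list B s -> #|B| = size s.
Proof. by case=> _ us -> _; rewrite cardsE (card_uniqP us). Qed.

Lemma bdeg_cycle B s x : cycle_list B s -> x \in B -> bdeg G B x = 2.
Proof.
move=> cB xB; rewrite /bdeg -sum1dep_card; have [_ us eB _] := cB.
have xs : x \in s by move: xB; rewrite eB inE.
have e := @big_cycle_nbrs _ _ addn B s x (fun=> 1) (index x s) cB.
by move: e; rewrite nth_index // => -> //; rewrite index_mem.
Qed.

Lemma bdeg_edge x y z : G x y -> z \in [set x; y] -> bdeg G [set x; y] z = 1.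
Proof.
move=> Gxy; wlog -> : x y Gxy / z = x => [h|_].
  move=> zin; move: (zin); rewrite !inE => /orP[]/eqP e; first exact: h.
  by rewrite setUC; apply: h; rewrite 1?adj_sym // setUC.
rewrite /bdeg (_ : [set _ in _ | _] = [set y]) ?cards1 //.
apply/setP=> w; rewrite !inE; case: eqVneq => [->|nwx] /=.
  by rewrite adj_irr (negPf (adj_neq Gxy)).
by case: eqP => // ->.
Qed.

(** An edge has degree sum 2, a k-cycle 2k. The form 2(k-1), plus 2 for a cycle, adds up over the
    blocks to the total in [sum_deg_cactus]. *)
Lemma sum_bdeg B : is_cactus G -> is_block G B ->
  \sum_(x in B) bdeg G B x = 2 * #|B|.-1 + 2 * (2 < #|B|).
Proof.
move=> cG /(cactus_block cG)[[x [y [Gxy ->]]]|[s cB]].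
  rewrite (eq_bigr (fun=> 1)); last by move=> z; apply: bdeg_edge.
  by rewrite sum1_card cards2 (adj_neq Gxy).
rewrite (eq_bigr (fun=> 2)); last by move=> z; apply: bdeg_cycle cB.
have [k2 _ _ _] := cB; rewrite sum_nat_const (card_cycle_list cB) k2; lia.
Qed.

Lemma block_card_gt1 B : is_cactus G -> is_block G B -> 1 < #|B|.
Proof.
move=> cG /(cactus_block cG)[[x [y [Gxy ->]]]|[s cB]].
  by rewrite cards2 (adj_neq Gxy).
by rewrite (card_cycle_list cB); case: cB; lia.
Qed.

End CactusBlocks.

Section Cycles.
Variables (V : finType) (G : sgraph V).
Implicit Types (A B : {set V}) (x y z u v : V).
Hypotheses (conG : connected G) (cactG : is_cactus G).

Lemma next_prev_neq (s : seq V) x : 2 < size s -> uniq s -> x \in s ->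
  next s x != prev s x.
Proof.
move=> k2 us xs; apply/eqP=> e; have := next_prev us x; rewrite -e.
have [x0 [i [ks <-]]] : exists x0 i, i < size s /\ nth x0 s i = x.
  by exists x, (index x s); rewrite index_mem nth_index.
have lt l : l < size s -> (if l.+1 == size s then 0 else l.+1) < size s.
  by move=> h; case: eqP => ?; lia.
rewrite !next_index ?lt // => /eqP; rewrite nth_uniq ?lt //.
case: (eqVneq i.+1 (size s)) => [h1|/eqP h1]; first by case: ifP => [/eqP h2|/eqP h2]; lia.
by case: ifP => [/eqP h2|/eqP h2]; lia.
Qed.

(** A cycle is nonseparable, so it lies in a block, itself a chordless cycle. There every vertex has
    only two neighbours, which the given cycle already uses; by connectedness it exhausts the
    block. *)
Lemma cycles_blocks : cycles G =
  [set (B, edges_in G B) | B in [set B | is_block G B & 2 < #|B|]].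
Proof.
apply/setP=> -[A E]; apply/idP/imsetP => [|[B]]; last first.
  rewrite !inE => /andP[bB k2] [-> ->] /=; apply/andP; split; last first.
    by apply/subsetP=> e; rewrite inE => /andP[].
  have /forallP/(_ B)/implyP/(_ bB)/orP[|//] := cactG.
  by case/existsP=> x /existsP[y /andP[_ /eqP eB]]; rewrite eB cards2 in k2; lia.
rewrite inE /= => /andP[/existsP[k /existsP[s /and4P[k2 us /eqP eA /eqP eE]]] sE].
have k2s : 2 < size s by rewrite size_tuple.
have nG x : x \in s -> G x (next s x).
  by move=> xs; rewrite -edgesE (subsetP sE) // eE; apply/imsetP; exists x.
have pG x : x \in s -> G x (prev s x).
  by move=> xs; rewrite adj_sym -{2}(next_prev us x) nG // mem_prev.
have cA : nonseparable G A.
  rewrite eA; apply: cycle_nonseparable => //; last exact: cycle_from_next.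
  by case: (val s) k2s.
have [B bB sAB] := nonseparable_sub_block cA.
have cardA : #|A| = size s by rewrite eA cardsE (card_uniqP us).
have k2B : 2 < #|B| by apply: leq_trans (subset_leq_card sAB); rewrite cardA.
have [[x [y [Gxy eB]]]|[s' cB]] := cactus_block cactG bB.
  by rewrite eB cards2 in k2B; lia.
have nbr x y : x \in s -> y \in B -> G x y -> (y == next s x) || (y == prev s x).
  move=> xs yB Gxy; have xB : x \in B by apply: (subsetP sAB); rewrite eA inE.
  have /setP/(_ y) : [set y in B | G x y] = [set next s x; prev s x].
    apply/eqP; rewrite eq_sym eqEcard -/(bdeg G B x) (bdeg_cycle cB xB) cards2.
    rewrite next_prev_neq // andbT; apply/subsetP=> z; rewrite !inE.
    by case/orP=> /eqP->; rewrite (subsetP sAB) ?nG ?pG // eA inE ?mem_next ?mem_prev.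
  by rewrite !inE yB Gxy.
have eAB : A = B.
  apply/eqP; rewrite eqEsubset sAB; apply/subsetP=> z zB; rewrite eA inE.
  have [x xs] : exists x, x \in s.
    by case/and3P: cA => /set0Pn[x]; rewrite eA inE => xs _ _; exists x.
  have xB : x \in B by apply: (subsetP sAB); rewrite eA inE.
  have /connected_inP/(_ x z xB zB)/connectP[p] := nonseparable_connected (block_nonseparable bB).
  elim: p x xs {xB} => [|y p IH] x xs /=; first by move=> _ ->.
  case/andP=> /and3P[_ yB Gxy]; apply: IH.
  by case/orP: (nbr _ _ xs yB Gxy) => /eqP->; rewrite ?mem_next ?mem_prev.
exists B; rewrite ?inE ?bB // eAB; congr (_, _); apply/setP=> e.
apply/idP/idP => [eE'|].
  rewrite inE (subsetP sE) //=; move: eE'; rewrite eE => /imsetP[x xs ->].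
  by apply/subsetP=> z; rewrite -eAB eA !inE => /orP[]/eqP->; rewrite ?mem_next.
rewrite inE => /andP[/edgesP[x [y [Gxy ->]]] /subsetP sxy].
have xs : x \in s by have := sxy x; rewrite -eAB eA !inE eqxx; apply.
have yB : y \in B by apply: sxy; rewrite !inE eqxx orbT.
rewrite eE; apply/imsetP; case/orP: (nbr _ _ xs yB Gxy) => /eqP->; first by exists x.
by exists (prev s x); rewrite ?mem_prev // next_prev // setUC.
Qed.

Lemma card_cycles : #|cycles G| = #|[set B | is_block G B & 2 < #|B|]|.
Proof. by rewrite cycles_blocks card_imset // => B B' []. Qed.

(** This recovers t from the degrees, so the cycles of [G0] and [G5] need never be listed. *)
Lemma sum_deg_cactus (u : V) : \sum_v deg G v = 2 * #|V|.-1 + 2 * #|cycles G|.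
Proof.
under eq_bigr => v _ do rewrite -deg_blocks.
rewrite (exchange_big_dep (is_block G)) /=; last by move=> v B _ /andP[].
transitivity (\sum_(B | is_block G B) (2 * #|B|.-1 + 2 * (2 < #|B|))).
  apply: eq_bigr => B bB; rewrite -(sum_bdeg cactG bB).
  by apply: eq_bigl => v; rewrite bB.
rewrite big_split /= -!big_distrr /= (sum_blocks_card conG u) card_cycles; congr (_ + 2 * _).
rewrite card_set_sum big_mkcond; apply: eq_bigr => B _.
by case: (is_block G B).
Qed.

End Cycles.

(** * Bouquets *)

Section Petals.
Variables (V : finType) (G : sgraph V).
Implicit Types (A B S : {set V}) (x y z u v a b c d : V).

Lemma triangle_list x y z : G x y -> G y z -> G z x ->
  cycle_list G [set x; y; z] [:: x; y; z].
Proof.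
move=> Gxy Gyz Gzx; have nxy := adj_neq Gxy; have nyz := adj_neq Gyz.
have nzx := adj_neq Gzx; have nyx := nxy; rewrite eq_sym in nyx.
have nzy := nyz; rewrite eq_sym in nzy. have nxz := nzx; rewrite eq_sym in nxz.
have Gyx : G y x by rewrite adj_sym. have Gzy : G z y by rewrite adj_sym.
have Gxz : G x z by rewrite adj_sym.
split=> //.
- by rewrite /= !inE negb_or nxy nxz nyz.
- by apply/setP=> w; rewrite !inE orbA.
move=> a b; rewrite !inE => /or3P[]/eqP-> /or3P[]/eqP->;
  rewrite /= ?eqxx ?(negPf nxy) ?(negPf nyz) ?(negPf nzx) ?(negPf nyx) ?(negPf nzy)
    ?(negPf nxz) ?eqxx ?(negPf nxy) ?(negPf nyz) ?(negPf nzx) ?(negPf nyx) ?(negPf nzy)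
    ?(negPf nxz) ?adj_irr ?Gxy ?Gyx ?Gyz ?Gzy ?Gzx ?Gxz ?orbT //.
Qed.

Lemma square_list x y z w : uniq [:: x; y; z; w] -> G x y -> G y z -> G z w -> G w x ->
  ~~ G x z -> ~~ G y w -> cycle_list G [set u in [:: x; y; z; w]] [:: x; y; z; w].
Proof.
move=> us Gxy Gyz Gzw Gwx nGxz nGyw; split=> //.
move: us; rewrite /= !inE !negb_or => /and4P[/and3P[nxy nxz nxw] /andP[nyz nyw] nzw _].
have nyx := nxy; rewrite eq_sym in nyx. have nzx := nxz; rewrite eq_sym in nzx.
have nwx := nxw; rewrite eq_sym in nwx. have nzy := nyz; rewrite eq_sym in nzy.
have nwy := nyw; rewrite eq_sym in nwy. have nwz := nzw; rewrite eq_sym in nwz.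
pose E := (eqxx, negPf nxy, negPf nxz, negPf nxw, negPf nyz, negPf nyw, negPf nzw,
  negPf nyx, negPf nzx, negPf nwx, negPf nzy, negPf nwy, negPf nwz).
move=> a b; rewrite !inE => /or4P[]/eqP-> /or4P[]/eqP->; rewrite /= ?E /= ?E ?adj_irr //;
  by rewrite 1?adj_sym ?Gxy ?Gyz ?Gzw ?Gwx ?(negPf nGxz) ?(negPf nGyw) //
     1?adj_sym ?Gxy ?Gyz ?Gzw ?Gwx ?(negPf nGxz) ?(negPf nGyw).
Qed.

Lemma cycle_list_nonseparable B s : cycle_list G B s -> nonseparable G B.
Proof.
case=> k2 us eB adjE; rewrite eB; apply: cycle_nonseparable => //; first by case: (s) k2.
by apply: cycle_from_next => // x xs; rewrite adjE ?mem_next // eqxx.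
Qed.

(* A bouquet at c of edges, triangles and, when S is nonempty, one special cycle c |: S. *)
Record petal_graph c S : Prop := PetalGraph {
  petal_center : c \notin S;
  petal_adj : forall x, x != c -> x \notin S -> G c x;
  petal_sep : forall x y, x != c -> x \notin S -> y \in S -> ~~ G x y;
  petal_match : forall x y z, x != c -> y != c -> z != c ->
    x \notin S -> y \notin S -> z \notin S -> G x y -> G x z -> y = z;
  petal_special : S = set0 \/ exists s, cycle_list G (c |: S) s }.

Section Structure.
Variables (c : V) (S : {set V}).
Hypothesis pG : petal_graph c S.

(** Meant for [x] other than the center. Outside [S] such an [x] has at most one neighbour besides
    [c], so its closed neighbourhood is the edge or triangle through it. *)
Definition petal x := if x \in S then c |: S else [set y | (y == x) || G x y].

Lemma special_cycle x : x \in S -> exists s, cycle_list G (c |: S) s.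
Proof. by move=> xS; case: (petal_special pG) => // S0; rewrite S0 inE in xS. Qed.

Lemma petal_sepC x y : x != c -> x \notin S -> G x y -> y \notin S.
Proof. by move=> nx xS; apply: contraL => /(petal_sep pG nx xS). Qed.

Lemma petal_cases x : x != c -> x \notin S ->
  petal x = [set c; x] \/
  exists y, [/\ y != c, y \notin S, G x y & petal x = [set c; x; y]].
Proof.
move=> nx xS; rewrite /petal (negPf xS).
have Gxc : G x c by rewrite adj_sym (petal_adj pG).
have [y /andP[nyc Gxy]|noy] := pickP (fun y => (y != c) && G x y).
  have yS := petal_sepC nx xS Gxy.
  right; exists y; split=> //; apply/setP=> z; rewrite !inE.
  have [->|nzc] := eqVneq z c; first by rewrite Gxc orbT.
  case: (eqVneq z x) => //= nzx; apply/idP/eqP => [Gxz|->//].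
  exact: (petal_match pG nx nzc nyc xS (petal_sepC nx xS Gxz) yS Gxz Gxy).
left; apply/setP=> z; rewrite !inE.
have [->|nzc] := eqVneq z c; first by rewrite Gxc orbT.
by case: (eqVneq z x) => //= _; have := noy z; rewrite nzc.
Qed.

Lemma petal_mem x : x != c -> (x \in petal x) && (c \in petal x).
Proof.
move=> nx; rewrite /petal; case: ifPn => xS; rewrite !inE ?eqxx ?xS ?orbT //=.
by rewrite adj_sym (petal_adj pG) ?orbT.
Qed.

Lemma petal_eq x y : x != c -> y != c -> G x y -> petal x = petal y.
Proof.
move=> nx ny Gxy; rewrite /petal; have Gyx : G y x by rewrite adj_sym.
have [xS|xS] := boolP (x \in S).
  by case: ifPn => // yS; have := petal_sepC ny yS Gyx; rewrite xS.
have yS := petal_sepC nx xS Gxy; rewrite (negPf yS).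
suff sub u v : u != c -> v != c -> u \notin S -> v \notin S -> G u v ->
    [set z | (z == u) || G u z] \subset [set z | (z == v) || G v z].
  by apply/eqP; rewrite eqEsubset !sub.
move=> nu nv uS vS Guv; apply/subsetP=> z; rewrite !inE => /orP[/eqP->|Guz].
  by rewrite adj_sym Guv orbT.
have [->|nz] := eqVneq z c; first by rewrite adj_sym (petal_adj pG) ?orbT.
by rewrite (petal_match pG nu nz nv uS _ vS Guz Guv) ?eqxx // (petal_sepC nu uS).
Qed.

Lemma petal_block_type x : x != c ->
  is_edge_block G (petal x) || is_cycle (petal x) (edges_in G (petal x)).
Proof.
move=> nx; have [xS|xS] := boolP (x \in S).
  rewrite /petal xS; have [s /cycle_list_is_cycle->] := special_cycle xS.
  by rewrite orbT.
have Gcx := petal_adj pG nx xS.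
have [->|[y [nyc yS Gxy ->]]] := petal_cases nx xS.
  by apply/orP; left; apply/existsP; exists c; apply/existsP; exists x; rewrite Gcx eqxx.
apply/orP; right; apply: cycle_list_is_cycle (triangle_list Gcx Gxy _).
by rewrite adj_sym (petal_adj pG).
Qed.

Lemma petal_nonseparable x : x != c -> nonseparable G (petal x).
Proof.
move=> nx; case/orP: (petal_block_type nx) => [|/is_cycle_list[s /cycle_list_nonseparable//]].
by case/existsP=> a /existsP[b /andP[Gab /eqP->]]; apply: edge_nonseparable.
Qed.

Lemma petal_connected : connected G.
Proof.
apply: (@connected_in_star _ _ _ c) => x _.
have [->|nx] := eqVneq x c; first exact: connect0.
have /andP[xP cP] := petal_mem nx.
have /connected_inP/(_ c x cP xP) := nonseparable_connected (petal_nonseparable nx).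
by apply: connect_inducedS; apply: subsetT.
Qed.

(** [petal] is constant along edges that avoid [c], and a block stays connected without [c]; so a
    block lies in one petal, and maximality gives equality. *)
Lemma petal_of_block B : 1 < #|V| -> is_block G B -> exists2 x, x != c & B = petal x.
Proof.
move=> V2 bB; have /card_gt1P[u [v [_ _ nuv]]] := V2.
(* A vertex apart from [c], for the case in which [B] would contain nothing but [c]. *)
have [x0 nx0] : exists x0, x0 != c.
  by have [e|] := eqVneq u c; [exists v; rewrite -e eq_sym | exists u].
have [x /andP[xB nx]|noB] := pickP (fun x => (x \in B) && (x != c)); last first.
  exists x0 => //; apply/esym/(block_max bB (petal_nonseparable nx0)).
  apply/subsetP=> y yB; have := noB y; rewrite yB /= => /negbT; rewrite negbK => /eqP->.
  by case/andP: (petal_mem nx0).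
exists x => //; apply/esym/(block_max bB (petal_nonseparable nx)); apply/subsetP=> y yB.
have /andP[_ cP] := petal_mem nx.
have [->//|ny] := eqVneq y c.
suff -> : petal x = petal y by case/andP: (petal_mem ny).
have xBc : x \in B :\ c by rewrite !inE nx.
have yBc : y \in B :\ c by rewrite !inE ny.
have /connected_inP/(_ _ _ xBc yBc)/connectP[p] := nonseparableD1 c (block_nonseparable bB).
elim: p x {cP xB xBc} nx => [|z p IH] x nx /=; first by move=> _ ->.
case/andP=> /and3P[_]; rewrite !inE => /andP[nz _] Gxz pp ey.
by rewrite (petal_eq nx nz Gxz); apply: IH.
Qed.

Lemma petal_cactus : 1 < #|V| -> is_cactus G.
Proof.
move=> V2; apply/forallP=> B; apply/implyP=> /(petal_of_block V2)[x nx ->].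
exact: petal_block_type.
Qed.

Lemma petal_center_block B : 1 < #|V| -> is_block G B -> c \in B.
Proof. by move=> V2 /(petal_of_block V2)[x nx ->]; case/andP: (petal_mem nx). Qed.

Lemma petal_card B : 1 < #|V| -> is_block G B -> B != c |: S -> #|B| <= 3.
Proof.
move=> V2 /(petal_of_block V2)[x nx ->].
have [xS|xS] := boolP (x \in S); first by rewrite /petal xS eqxx.
have [->|[y [_ _ _ ->]]] := petal_cases nx xS; move=> _; first by rewrite cards2; case: eqP.
by rewrite -setUA cardsU1 cards2; case: (c \notin _); case: (x != y).
Qed.

Lemma special_block x : 1 < #|V| -> x \in S -> is_block G (c |: S).
Proof.
move=> V2 xS; have nx : x != c by apply: contraNneq (petal_center pG) => <-.
have := petal_nonseparable nx; rewrite /petal xS => /nonseparable_sub_block[B bB sB].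
suff -> : c |: S = B by [].
have [y ny eB] := petal_of_block V2 bB.
have [yS|yS] := boolP (y \in S); first by rewrite eB /petal yS.
have : x \in B by apply: (subsetP sB); rewrite !inE xS orbT.
rewrite eB /petal (negPf yS) inE => /orP[/eqP e|]; first by rewrite -e xS in yS.
by move=> /(petal_sepC ny yS); rewrite xS.
Qed.

End Structure.

(** * From concentrated blocks to a bouquet *)

Section Concentrated.
Hypotheses (conG : connected G) (cactG : is_cactus G).

(** A vertex outside [B] lies in another block, which also contains [c] and therefore projects to
    [c]. *)
Lemma center_concentrated c B : (forall B', is_block G B' -> c \in B') ->
  is_block G B -> concentrated G B.
Proof.
move=> hc bB; apply/exists_inP; exists c; first exact: hc.
apply/forall_inP=> a aB; apply/implyP=> nac; rewrite /fibN.
suff -> : [set v | proj G B v == a] = [set a] by rewrite cards1.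
apply/setP=> v; rewrite !inE; apply/eqP/eqP => [|->]; last exact: proj_id.
have [vB|vB] := boolP (v \in B); first by rewrite proj_id.
have nvc : c != v by apply: contraNneq vB => <-; apply: hc.
have [B' bB' /andP[vB' _]] := proj_separating_block conG nvc.
have nBB' : B != B' by apply: contraNneq vB => ->.
rewrite (proj_block conG bB bB' nBB' vB' (hc _ bB')) (proj_id conG bB (hc _ bB)).
by move=> e; rewrite e eqxx in nac.
Qed.

(** All of [B'] falls into one fiber. In particular a vertex of [B] that lies in a second block has
    a nontrivial fiber. *)
Lemma fibN_other_block B B' y : is_block G B -> is_block G B' -> B != B' -> y \in B' ->
  1 < fibN G B (proj G B y).
Proof.
move=> bB bB' nB yB'; apply: leq_trans (block_card_gt1 cactG bB') _.
apply: subset_leq_card; apply/subsetP=> z zB'; rewrite inE; apply/eqP.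
exact: (proj_block conG bB bB').
Qed.

(** Since n exceeds every block size, each block has exactly one vertex with a nontrivial fiber. A
    vertex shared by two blocks is such a vertex for both, so no block can link its neighbours
    through two different vertices. *)
Lemma concentrated_center : 7 <= #|V| ->
  (forall B, is_block G B -> concentrated G B /\ #|B| <= 4) ->
  exists c, forall B, is_block G B -> c \in B.
Proof.
move=> n7 hB.
have cent B : is_block G B -> exists c, [/\ c \in B, 1 < fibN G B c &
    forall a, a \in B -> 1 < fibN G B a -> a = c].
  move=> bB; have [/exists_inP[c cB /forall_inP hc] k4] := hB B bB.
  have h a : a \in B -> a != c -> fibN G B a = 1.
    by move=> aB nac; apply/eqP; have /implyP := hc a aB; apply.
  exists c; split=> // [|a aB]; last by apply: contraTeq => nac; rewrite h.
  have := sum_fibN conG bB; rewrite (bigD1 c) //= (eq_bigr (fun=> 1)); last first.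
    by move=> a /andP[aB nac]; apply: h.
  have := cardsD1 c B; rewrite cB sum1dep_card => eB.
  have -> : #|[set x | (x \in B) && (x != c)]| = #|B :\ c|.
    by apply: eq_card => x; rewrite !inE andbC.
  move=> eN; rewrite eB add1n ltnS in k4; move: n7; rewrite -eN.
  by move=> n7; rewrite -(ltn_add2r 3) (leq_trans _ (leq_trans n7 _)) ?leq_add2l.
have /card_gt1P[u [v [_ _ nuv]]] : 1 < #|V| by lia.
have [B0 b0 _] := proj_separating_block conG nuv.
have [c [cB0 _ c_uniq]] := cent B0 b0.
exists c => B' bB'; apply/negPn/negP=> cB'.
have nB0 : B0 != B' by apply: contraNneq cB' => <-.
have p_in := proj_in conG c bB'; set c' := proj G B' c in p_in.
have ncc' : c != c' by apply: contraNneq cB' => ->.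
(* [B2] is the block at [c'] that leads towards [c]; it meets [B'] at [c'], whose fiber is thus
   nontrivial. If [B2] is [B0], this contradicts the choice of [c]; otherwise [B0] makes the fiber
   of the projection of [c] a second nontrivial one. *)
have [B2 b2 /andP[c'B2 nc2]] := proj_separating_block conG ncc'.
have nB2 : B2 != B' by apply: contraNneq nc2 => ->.
have f1 := fibN_other_block b2 bB' nB2 p_in; rewrite proj_id // in f1.
have [e|nB20] := eqVneq B2 B0.
  by move: ncc'; rewrite (c_uniq c') ?eqxx -?e.
have f2 := fibN_other_block b2 b0 nB20 cB0.
have [c2 [_ _ c2_uniq]] := cent B2 b2.
move: nc2; rewrite (c2_uniq _ c'B2 f1) (c2_uniq _ _ f2) ?eqxx //.
exact: proj_in.
Qed.

Lemma small_block_complete B x y : is_block G B -> #|B| <= 3 ->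
  x \in B -> y \in B -> x != y -> G x y.
Proof.
move=> bB k3; have [[a [b [Gab ->]]]|[s cB]] := cactus_block cactG bB.
  rewrite !inE => /orP[]/eqP-> /orP[]/eqP->; rewrite ?eqxx //.
  by rewrite adj_sym.
have [k2 us eB _] := cB; have es : size s = 3 by rewrite (card_cycle_list cB) in k3; lia.
rewrite {1 2}eB !inE => xs ys nxy.
have ix : index x s < size s by rewrite index_mem.
have iy : index y s < size s by rewrite index_mem.
have nixy : index x s != index y s.
  by apply: contra nxy => /eqP e; rewrite -(nth_index x xs) e nth_index.
rewrite -(nth_index x xs) -(nth_index x ys) (cycle_list_adj _ cB) //.
move: ix iy nixy; rewrite es.
by case: (index x s) => [|[|[|]]] //; case: (index y s) => [|[|[|]]].
Qed.

Lemma center_petal_graph c : 1 < #|V| ->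
  (forall B, is_block G B -> c \in B /\ #|B| <= 4) ->
  (forall B B', is_block G B -> is_block G B' -> #|B| = 4 -> #|B'| = 4 -> B = B') ->
  (petal_graph c set0) \/ exists2 B, is_block G B /\ #|B| = 4 & petal_graph c (B :\ c).
Proof.
move=> V2 hB uniq4.
have hc B : is_block G B -> c \in B by case/hB.
have pet S : c \notin S -> (forall B, is_block G B -> #|B| = 4 -> B :\ c \subset S) ->
  (forall x y, x != c -> x \notin S -> y \in S -> ~~ G x y) ->
  (S = set0 \/ exists s, cycle_list G (c |: S) s) -> petal_graph c S.
  move=> cS S4 sepS specS.
  have k3 B x : is_block G B -> x \in B -> x != c -> x \notin S -> #|B| <= 3.
    move=> bB xB nx xS; have [_] := hB B bB; rewrite leq_eqVlt => /orP[/eqP e4|//].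
    by case/negP: xS; apply: (subsetP (S4 B bB e4)); rewrite !inE nx.
  split=> // [x nx xS|x y z nx ny nz xS yS zS Gxy Gxz].
    have ncx : c != x by rewrite eq_sym.
    have [B bB /andP[xB _]] := proj_separating_block conG ncx.
    by apply: (small_block_complete bB) => //; [apply: k3 xS | apply: hc].
  (* The blocks of both edges contain [x] and [c], so they coincide; distinct [y] and [z] would give
     this block four vertices. *)
  have [B [bB xB yB]] := edge_block Gxy; have [B' [bB' xB' zB']] := edge_block Gxz.
  have eB := block_inter bB bB' nx xB xB' (hc _ bB) (hc _ bB').
  rewrite -eB in zB'; apply: contraTeq (k3 B x bB xB nx xS) => nyz; rewrite -ltnNge.
  have us : uniq [:: c; x; y; z].
    rewrite /= !inE !negb_or ![c == _]eq_sym nx ny nz (adj_neq Gxy) (adj_neq Gxz).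
    by rewrite nyz.
  rewrite -(card_uniqP us : _ = 4); apply: subset_leq_card; apply/subsetP=> w.
  by rewrite !inE => /or4P[]/eqP->; rewrite ?hc.
have [B /andP[bB /eqP e4]|no4] := pickP (fun B => is_block G B && (#|B| == 4)); last first.
  left; apply: pet; rewrite ?inE //; last by left.
    by move=> B bB e4; have := no4 B; rewrite bB e4.
  by move=> x y _ _; rewrite inE.
right; exists B => //; apply: pet.
- by rewrite !inE eqxx.
- by move=> B' bB' e4'; rewrite (uniq4 B' B).
- move=> x y nx; rewrite !inE nx /= => xB /andP[ny yB]; apply/negP=> Gxy.
  have [B' [bB' xB' yB']] := edge_block Gxy.
  case/negP: xB; rewrite -(block_inter bB' bB ny yB' yB (hc _ bB') (hc _ bB)) //.
right; rewrite setD1K ?hc //.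
have [[x [y [_ eB]]]|//] := cactus_block cactG bB.
by rewrite eB cards2 in e4; move: e4; case: (x != y).
Qed.

End Concentrated.

End Petals.

(** * Recognition of G0 and G5 from a list of vertices *)

Definition paired (p i j : nat) := [&& ~~ odd i, j == i.+1 & j < p.*2].

(** A relation of degree at most one is a matching. Matched pairs go to the front of the list, which
    is the numbering of the triangles in [G0] and [G5] up to an offset of 1 and 4. *)
Lemma matching_list (V : finType) (e : rel V) (X : {set V}) :
  symmetric e -> irreflexive e ->
  {in X & &, forall x y z, e x y -> e x z -> y = z} ->
  exists s p, [/\ uniq s, s =i X, p.*2 <= size s &
    forall x0 i j, i < size s -> j < size s ->
      e (nth x0 s i) (nth x0 s j) = paired p i j || paired p j i].
Proof.
move=> es ei; elim: {X}_.+1 {-2}X (ltnSn #|X|) => // m IH X leX mX.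
have [xy /= /and3P[xX yX exy]|noe] :=
  pickP (fun xy : V * V => [&& xy.1 \in X, xy.2 \in X & e xy.1 xy.2]); last first.
  exists (enum X), 0; split; [exact: enum_uniq|exact: mem_enum|by []|move=> x0 i j iX jX].
  rewrite /paired double0 !ltn0 !andbF /=.
  have := noe (nth x0 (enum X) i, nth x0 (enum X) j); rewrite /=.
  by rewrite -[_ i \in X]mem_enum -[_ j \in X]mem_enum !mem_nth.
case: xy xX yX exy => x y /= xX yX exy.
have nxy : x != y by apply: contraTneq exy => ->; rewrite ei.
have eyx : e y x by rewrite es.
have cX : #|X :\ x :\ y| < m.
  have := cardsD1 x X; have := cardsD1 y (X :\ x).
  rewrite !inE xX yX eq_sym nxy /=; lia.
have mX' : {in X :\ x :\ y & &, forall x y z, e x y -> e x z -> y = z}.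
  move=> a b d /setD1P[_ /setD1P[_ ?]] /setD1P[_ /setD1P[_ ?]] /setD1P[_ /setD1P[_ ?]].
  exact: mX.
have [s [p [us sE ps adj]]] := IH _ cX mX'.
exists [:: x, y & s], p.+1; split.
- by rewrite /= us inE !sE !inE !eqxx (negPf nxy) /= ?andbF.
- move=> z; rewrite !inE sE !inE; have [->|] := eqVneq z x; first by rewrite xX.
  by have [->|] := eqVneq z y; rewrite ?yX.
- by rewrite doubleS /= !ltnS.
move=> x0 i j; have nth_in k : k < size s -> nth x0 s k \in X /\ nth x0 s k != x /\ nth x0 s k != y.
  by move=> /(mem_nth x0); rewrite sE !inE => /and3P[-> -> ->].
have ex k : k < size s -> e x (nth x0 s k) = false.
  move=> /nth_in[kX [_ ny]]; apply: contraNF ny => exk.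
  by rewrite (mX x y (nth x0 s k)).
have ey k : k < size s -> e y (nth x0 s k) = false.
  move=> /nth_in[kX [nx _]]; apply: contraNF nx => eyk.
  by rewrite (mX y x (nth x0 s k)).
case: i => [|[|i]]; case: j => [|[|j]] => /= hi hj; rewrite ?ei ?exy ?eyx ?ex ?ey //;
  try by [rewrite /paired /= ?andbF | rewrite es ?ex ?ey // /paired /= ?andbF].
  by rewrite adj // /paired /= !negbK doubleS !eqSS.
Qed.

Lemma iso_of_list (V : finType) (G : sgraph V) n (H : sgraph 'I_n) x0 (s : seq V) :
  uniq s -> size s = n -> (forall x, x \in s) ->
  (forall i j : 'I_n, G (nth x0 s i) (nth x0 s j) = H i j) -> isomorphic G H.
Proof.
move=> us sn sV adj; have h x : index x s < n by rewrite -sn index_mem.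
exists (fun x => Ordinal (h x)) => [|x y]; last by rewrite -adj /= !nth_index.
exists (fun i : 'I_n => nth x0 s i) => [x|i] /=; first by rewrite nth_index.
by apply: val_inj; rewrite /= index_uniq // sn.
Qed.

Lemma sum_deg_iso (V W : finType) (G : sgraph V) (H : sgraph W) :
  isomorphic G H -> \sum_v deg G v = \sum_w deg H w.
Proof.
case=> f bf adj; rewrite (reindex f) /=; last exact: onW_bij.
apply: eq_bigr => v _; rewrite /deg !card_set_sum (reindex f) /=; last exact: onW_bij.
by apply: eq_bigr => w _; rewrite adj.
Qed.

(** Each edge is counted at its larger endpoint; in [G0] and [G5] a vertex has at most two smaller
    neighbours. *)
Lemma sum_deg_ord n (H : sgraph 'I_n) (g : rel nat) :
  symmetric g -> irreflexive g -> (forall i j : 'I_n, H i j = g i j) ->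
  \sum_i deg H i = 2 * \sum_(m < n) \sum_(i < m) g i m.
Proof.
move=> gs gi Hg; transitivity (\sum_(i < n) \sum_(j < n) g i j).
  apply: eq_bigr => i _; rewrite /deg card_set_sum.
  by apply: eq_bigr => j _; rewrite Hg.
elim: n {H Hg} => [|n IH]; first by rewrite !big_ord0.
have eS : \sum_(i < n) g n i = \sum_(i < n) g i n by apply: eq_bigr => i _; rewrite gs.
rewrite !big_ord_recr /= gi addn0 (eq_bigr (fun i : 'I_n => \sum_(j < n) g i j + g i n)).
  by rewrite big_split /= IH eS; ring.
by move=> i _; rewrite big_ord_recr.
Qed.

(** [g0] and [g5] extend the adjacency of [G0] and [G5] to all natural numbers, independently of n,
    for induction on n and linear arithmetic. *)
Definition g0 t : rel nat := [rel x y | (x != y) &&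
  (((x == 0) || [&& odd x, y == x.+1 & y <= t.*2]) ||
   ((y == 0) || [&& odd y, x == y.+1 & x <= t.*2]))].

Definition g5 t : rel nat :=
  let r x y := [|| (x == 0) && (y != 2), (x == 1) && (y == 2), (x == 2) && (y == 3) |
        [&& 4 <= x, ~~ odd x, y == x.+1 & y <= t.*2.+1]] in
  [rel x y | (x != y) && (r x y || r y x)].

Lemma G0E n t (i j : 'I_n) : G0 n t i j = g0 t i j.
Proof. by []. Qed.

Lemma G5E n t (i j : 'I_n) : G5 n t i j = g5 t i j.
Proof. by []. Qed.

Lemma sum_deg_G0 n t : t.*2 < n -> \sum_i deg (G0 n t) i = 2 * n.-1 + 2 * t.
Proof.
move=> tn; rewrite (@sum_deg_ord _ _ (g0 t)); first last.
- exact: G0E.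
- by move=> x; rewrite /g0 /g5 /= eqxx.
- by move=> x y; rewrite /g0 /g5 /= orbC eq_sym.
(* Every vertex but 0 sees 0; a positive even one up to 2t also closes a triangle with its
   predecessor. *)
have low m : \sum_(i < m) g0 t i m = (m != 0) + [&& ~~ odd m, 0 < m & m <= t.*2].
  case: m => [|[|m]]; first by rewrite big_ord0.
    by rewrite big_ord_recl big_ord0.
  rewrite big_ord_recl big_ord_recr big1 /=.
rewrite /g0 /bump leq0n !add1n /= negbK eqxx /=. by lia.
  by move=> i _; have := ltn_ord i; rewrite /g0 /g5 /bump leq0n !add1n /=; lia.
under eq_bigr => m _ do rewrite low.
rewrite big_split /=.
have -> : \sum_(m < n) (m != 0 :> nat) = n.-1.
  by elim: n {tn} => [|n IH]; rewrite ?big_ord0 // big_ord_recr /= IH; case: n {IH} => //; lia.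
have -> : \sum_(m < n) [&& ~~ odd m, 0 < m & m <= t.*2] = minn t n.-1./2.
  by elim: n {tn} => [|n IH]; rewrite ?big_ord0 ?big_ord_recr /= ?IH; lia.
lia.
Qed.

Lemma sum_deg_G5 n t : 0 < t -> t.*2.+1 < n -> \sum_i deg (G5 n t) i = 2 * n.-1 + 2 * t.
Proof.
move=> t0 tn; rewrite (@sum_deg_ord _ _ (g5 t)); first last.
- exact: G5E.
- by move=> x; rewrite /g0 /g5 /= eqxx.
- by move=> x y; rewrite /g0 /g5 /= orbC eq_sym.
(* Vertex 2 sees 1 in place of 0, vertex 3 closes the 4-cycle, and an odd vertex from 5 to 2t+1
   closes a triangle. *)
have low m : \sum_(i < m) g5 t i m = (m != 0) + (m == 3) + [&& odd m, 4 < m & m <= t.*2.+1].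
  case: m => [|[|[|[|m]]]]; first by rewrite big_ord0.
  - by rewrite big_ord_recl big_ord0.
  - by rewrite !big_ord_recl big_ord0.
  - by rewrite !big_ord_recl big_ord0.
  rewrite big_ord_recl big_ord_recr big1 /=.
rewrite /g5 /bump !leq0n !add1n /= ?negbK. by lia.
  by move=> i _; have := ltn_ord i; rewrite /g0 /g5 /bump leq0n !add1n /=; lia.
under eq_bigr => m _ do rewrite low.
rewrite !big_split /=.
have -> : \sum_(m < n) (m != 0 :> nat) = n.-1.
  by elim: n {tn} => [|n IH]; rewrite ?big_ord0 // big_ord_recr /= IH; case: n {IH} => //; lia.
have -> : \sum_(m < n) (m == 3 :> nat) = (3 < n).
  by elim: n {tn} => [|n IH]; rewrite ?big_ord0 ?big_ord_recr /= ?IH; lia.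
have -> : \sum_(m < n) [&& odd m, 4 < m & m <= t.*2.+1] = minn t.-1 (n - 4)./2.
  by elim: n {tn} => [|n IH]; rewrite ?big_ord0 ?big_ord_recr /= ?IH; lia.
lia.
Qed.

Section Recognition.
Variables (V : finType) (G : sgraph V).
Implicit Types (B S : {set V}) (x y z c : V).

Lemma petal_matching_list c S : petal_graph G c S ->
  exists s p, [/\ uniq s, s =i ~: (c |: S), p.*2 <= size s &
    forall x0 i j, i < size s -> j < size s ->
      G (nth x0 s i) (nth x0 s j) = paired p i j || paired p j i].
Proof.
move=> pG; apply: matching_list; [exact: adj_sym | exact: adj_irr |].
move=> x y z; rewrite !inE !negb_or => /andP[nx xS] /andP[ny yS] /andP[nz zS].
exact: (petal_match pG).
Qed.

Lemma petal_graph_G0 c : petal_graph G c set0 ->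
  exists2 p, p.*2 < #|V| & isomorphic G (G0 #|V| p).
Proof.
move=> pG; have [s [p [us sE ps adj]]] := petal_matching_list pG.
have sV x : x \in c :: s by rewrite inE sE !inE; case: eqP.
have uV : uniq (c :: s) by rewrite /= us sE !inE eqxx.
have sn : size (c :: s) = #|V|.
  by rewrite -(card_uniqP uV); apply: eq_card => x; rewrite sV.
have cadj i : i < size s -> G c (nth c s i).
  move=> /(mem_nth c); rewrite sE !inE => /norP[nx _].
  by apply: (petal_adj pG); rewrite ?inE.
exists p; first by rewrite -sn /= ltnS.
apply: (iso_of_list (x0 := c) uV sn sV) => i j; rewrite G0E.
have : i < size (c :: s) by rewrite sn.
have : j < size (c :: s) by rewrite sn.
move: (i : nat) (j : nat) => {i j} [|i] [|j] /=; rewrite ?adj_irr ?ltnS => hj hi.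
- by [].
- by rewrite cadj.
- by rewrite adj_sym cadj // /g0 /= orbT.
rewrite adj //= /g0 /paired /= !eqSS; lia.
Qed.

Lemma cycle_list_rot B s k : cycle_list G B s -> cycle_list G B (rot k s).
Proof.
case=> k2 us eB adjE; split; rewrite ?size_rot ?rot_uniq //.
  by rewrite eB; apply/setP=> x; rewrite !inE mem_rot.
by move=> x y; rewrite !mem_rot !next_rot //; apply: adjE.
Qed.

Lemma petal_graph_G5 c B : is_cactus G -> is_block G B -> #|B| = 4 -> c \in B ->
  petal_graph G c (B :\ c) ->
  exists p, [/\ 0 < p, p.*2.+1 < #|V| & isomorphic G (G5 #|V| p)].
Proof.
move=> cactG bB e4 cB pG.
have [[x [y [_ eB]]]|[s4' cB']] := cactus_block cactG bB.
  by rewrite eB cards2 in e4; move: e4; case: (x != y).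
have cs4 : c \in s4' by case: cB' => _ _ eB _; move: cB; rewrite eB inE.
(* Start the 4-cycle at [c], as the numbering of [G5] does. *)
have [k q erot] := rot_to cs4; have := cycle_list_rot k cB'; rewrite erot => {cB' erot cs4}.
have [s [p [us sE ps adj]]] := petal_matching_list pG; rewrite setD1K // in sE.
move=> cB'; have := card_cycle_list cB'; rewrite e4.
case: q cB' => [|a [|b [|d [|? ?]]]] //= cl _; have [_ us4 eB _] := cl.
have sV x : x \in [:: c, a, b, d & s].
  have : x \in [:: c; a; b; d] ++ s.
    by rewrite mem_cat sE eB !inE orbN.
  by rewrite mem_cat !inE -!orbA.
have uV : uniq [:: c, a, b, d & s].
  rewrite -[X in uniq X]/([:: c; a; b; d] ++ s) cat_uniq us4 us andbT /=.
  by apply/hasPn=> x; rewrite sE eB !inE.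
have sn : size [:: c, a, b, d & s] = #|V|.
  by rewrite -(card_uniqP uV); apply: eq_card => x; rewrite sV.
have outs i : i < size s -> (nth c s i != c) && (nth c s i \notin B :\ c).
  move=> /(mem_nth c); rewrite sE !inE => iB.
  have nc : nth c s i != c by apply: contraNneq iB => ->.
  by rewrite nc (negPf iB).
have cadj i : i < size s -> G c (nth c s i).
  by move=> /outs/andP[nx xS]; apply: (petal_adj pG).
have inadj w i : w \in B :\ c -> i < size s -> G w (nth c s i) = false.
  by move=> wB /outs/andP[nx xS]; rewrite adj_sym; apply/negbTE/(petal_sep pG).
have [aB bB' dB] : [/\ a \in B :\ c, b \in B :\ c & d \in B :\ c].
  move: us4; rewrite eB /= !inE !negb_or => /andP[/and3P[ca cb cd] _].
  by rewrite !eqxx ![_ == c]eq_sym ca cb cd !orbT.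
(* The 4-cycle counts as one cycle next to the [p] triangles. *)
exists p.+1; split=> //; first by rewrite -sn doubleS /= !ltnS.
have adj4 i j : i < 4 -> j < 4 -> G (nth c [:: c; a; b; d] i) (nth c [:: c; a; b; d] j) =
   (j == if i.+1 == 4 then 0 else i.+1) || (j == if i == 0 then 3 else i.-1).
  by move=> hi hj; rewrite (cycle_list_adj _ cl).
apply: (iso_of_list (x0 := c) uV sn sV) => i j; rewrite G5E.
have : j < size [:: c, a, b, d & s] by rewrite sn.
have : i < size [:: c, a, b, d & s] by rewrite sn.
move: (i : nat) (j : nat) => {}i {}j /=.
case: (ltnP i 4) => hi4; case: (ltnP j 4) => hj4.
- by move=> _ _; move: (adj4 i j hi4 hj4); case: i hi4 => [|[|[|[|]]]] // _;
    case: j hj4 => [|[|[|[|]]]].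
- have [m ->] : exists m, j = m.+4 by exists (j - 4); lia.
  rewrite !ltnS => _ hm.
  case: i hi4 => [|[|[|[|]]]] //= _;
    by [rewrite cadj | rewrite inadj // /g5 /= ?andbF].
- have [m ->] : exists m, i = m.+4 by exists (i - 4); lia.
  rewrite !ltnS => hm _.
  case: j hj4 => [|[|[|[|]]]] //= _; rewrite adj_sym;
    by [rewrite cadj // /g5 /= ?orbT | rewrite inadj // /g5 /= ?andbF].
have [m ->] : exists m, i = m.+4 by exists (i - 4); lia.
have [l ->] : exists l, j = l.+4 by exists (j - 4); lia.
rewrite !ltnS => hm hl; rewrite /= adj // /g5 /paired /=; lia.
Qed.

End Recognition.

Lemma G0_petal_graph n t (n0 : 0 < n) : t.*2 < n ->
  petal_graph (G0 n t) (Ordinal n0) set0.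
Proof.
move=> tn; split=> [|x|x y|x y z|]; rewrite ?inE //; last by left.
  by rewrite -val_eqE G0E /g0 /= => nx _; rewrite eq_sym nx.
rewrite -!val_eqE !G0E /g0 /= => nx ny nz _ _ _ hxy hxz; apply: val_inj => /=; lia.
Qed.

Lemma G5_petal_graph n t (n3 : 3 < n) : 0 < t -> t.*2.+1 < n ->
  exists S, [/\ petal_graph (G5 n t) (Ordinal (leq_trans (isT : 0 < 4) n3)) S,
    S != set0 & #|(Ordinal (leq_trans (isT : 0 < 4) n3)) |: S| = 4].
Proof.
move=> t0 tn; set c := Ordinal _.
pose a := Ordinal (leq_trans (isT : 1 < 4) n3); pose b := Ordinal (leq_trans (isT : 2 < 4) n3).
pose d := Ordinal (leq_trans (isT : 3 < 4) n3).
exists [set x : 'I_n | 0 < x < 4].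
have eS : c |: [set x : 'I_n | 0 < x < 4] = [set x in [:: c; a; b; d]].
  by apply/setP=> x; rewrite !inE -!val_eqE /=; lia.
have cl : cycle_list (G5 n t) (c |: [set x : 'I_n | 0 < x < 4]) [:: c; a; b; d].
  by rewrite eS; apply: square_list.
split; last by rewrite (card_cycle_list cl).
  split=> [|x|x y|x y z|]; rewrite ?inE //; last by right; exists [:: c; a; b; d].
  - by rewrite -val_eqE G5E /g5 /=; lia.
  - by rewrite -val_eqE G5E /g5 /=; lia.
  rewrite -!val_eqE !G5E /g5 /= => nx ny nz xS yS zS hxy hxz; apply: val_inj => /=; lia.
by apply/set0Pn; exists a; rewrite inE.
Qed.

Local Open Scope ring_scope.

(** * Resistances *)

Section CycleResistance.
Variable R : realFieldType.

(** Two arcs of d = |i - j| and k - d unit resistors in parallel: d(k-d)/k = d - d^2/k. *)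
Definition cycle_res (k i j : nat) : R :=
  `|i%:R - j%:R| - (i%:R - j%:R) ^+ 2 / k%:R.

(** At k = 2 the cycle formula would give 1/2, the value for a double edge; hence the separate
    case. *)
Definition res_sum (k : nat) : R :=
  if k == 2%N then 1 else (k%:R ^+ 2 - 1) / 6%:R.

Lemma normrB_le (i j : nat) : (j <= i)%N -> `|i%:R - j%:R| = i%:R - j%:R :> R.
Proof. by move=> h; rewrite ger0_norm // subr_ge0 ler_nat. Qed.

Lemma normrB_ge (i j : nat) : (i <= j)%N -> `|i%:R - j%:R| = j%:R - i%:R :> R.
Proof. by move=> h; rewrite distrC normrB_le. Qed.

Lemma cycle_resC k i j : cycle_res k i j = cycle_res k j i.
Proof. by rewrite /cycle_res distrC; congr (_ - _ / _); ring. Qed.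

Lemma cycle_res0 k i : cycle_res k i i = 0.
Proof. by rewrite /cycle_res subrr normr0 expr0n mul0r subrr. Qed.

Lemma cycle_res_ge_half k i j : (i < k)%N -> (j < k)%N -> i != j ->
  1 / 2%:R <= cycle_res k i j.
Proof.
wlog ij : i j / (i < j)%N => [h ik jk nij|ik jk _].
  have [l|l] := ltnP i j; first exact: h.
  by rewrite cycle_resC; apply: h; lia.
(* Both arcs are nonempty; their lengths are d + 1 and e + 1. *)
have [d ed] : exists d, (j = i + d.+1)%N by exists (j - i).-1; lia.
have [e ke] : exists e, (k = d.+2 + e)%N by exists (k - d.+2)%N; lia.
have d0 : 0 <= d%:R :> R := ler0n R d.
have e0 : 0 <= e%:R :> R := ler0n R e.
have de0 := mulr_ge0 d0 e0.
have k0 : 0 < d%:R + e%:R + 2 :> R by lra.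
have -> : cycle_res k i j = (d%:R + 1) * (e%:R + 1) / (d%:R + e%:R + 2).
  rewrite /cycle_res normrB_ge ?(ltnW ij) // ed ke !(natrD, =^~natr1).
  by field; apply: lt0r_neq0; lra.
by rewrite ler_pdivlMr //; lra.
Qed.


Lemma sum_cycle_res k i : (i < k)%N -> \sum_(j < k) cycle_res k i j = (k%:R ^+ 2 - 1) / 6%:R.
Proof.
move=> ik; rewrite /cycle_res sumrB -mulr_suml.
have sq m : \sum_(j < m) (i%:R - j%:R) ^+ 2 =
   m%:R * i%:R ^+ 2 - i%:R * m%:R * (m%:R - 1) + m%:R * (m%:R - 1) * (2%:R * m%:R - 1) / 6%:R :> R.
  elim: m => [|m IH]; first by rewrite big_ord0; ring.
  by rewrite big_ord_recr /= IH -natr1; field.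
(* The absolute value is resolved by summing up to i, then from i on. *)
have lo m : (m <= i)%N -> \sum_(j < m) `|i%:R - j%:R| = m%:R * i%:R - m%:R * (m%:R - 1) / 2%:R :> R.
  elim: m => [|m IH] mi; first by rewrite big_ord0; field.
  by rewrite big_ord_recr /= IH ?normrB_le ?(ltnW mi) // -natr1; field.
have hi d : \sum_(j < i + d) `|i%:R - j%:R| =
    i%:R * (i%:R + 1) / 2%:R + d%:R * (d%:R - 1) / 2%:R :> R.
  elim: d => [|d IH]; first by rewrite addn0 lo //; field.
  by rewrite addnS big_ord_recr /= IH normrB_ge ?leq_addr // natrD -natr1; field.
have [d ke] : exists d, (k = i + d)%N by exists (k - i)%N; lia.
have k0 : k%:R != 0 :> R by rewrite pnatr_eq0; lia.
have -> : \sum_(j < k) `|i%:R - j%:R| = i%:R * (i%:R + 1) / 2%:R + d%:R * (d%:R - 1) / 2%:R :> R.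
  by rewrite ke hi.
rewrite sq; have -> : d%:R = k%:R - i%:R :> R by rewrite ke natrD; ring.
by field.
Qed.


(* d(k-d)/k has second difference -2/k and is invariant under d -> k-d. *)
Lemma cycle_res_laplacian k i j : (2 < k)%N -> (i < k)%N -> (j < k)%N ->
  (cycle_res k i j - cycle_res k (if i.+1 == k then 0 else i.+1)%N j)
  + (cycle_res k i j - cycle_res k (if i == 0 then k.-1 else i.-1)%N j)
  = 2%:R / k%:R - 2%:R * (i == j)%:R.
Proof.
move=> k2 ik jk.
have k0 : k%:R != 0 :> R by rewrite pnatr_eq0; lia.
have nB := normrB_le; have nG := normrB_ge.
have [->|ni0] := eqVneq i 0%N.
  have -> : (1 == k)%N = false by lia.
  have ek : k.-1%:R = k%:R - 1 :> R by rewrite -subn1 natrB //; lia.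
  have [<-|nj] := eqVneq 0%N j.
    by rewrite [nat_of_bool _]/= cycle_res0 /cycle_res !nB // ek; field.
  by rewrite [nat_of_bool _]/= /cycle_res (nG 0%N) // (nG 1%N) ?(nB k.-1) ?ek; [field| lia..].
have ei : i.-1%:R = i%:R - 1 :> R by rewrite -subn1 natrB //; lia.
case: ifP => [/eqP ik1|nik].
  have ek : k%:R = i%:R + 1 :> R by rewrite -ik1 natr1.
  have [<-|nj] := eqVneq i j.
    by rewrite [nat_of_bool _]/= cycle_res0 /cycle_res (nG 0%N) // (nG i.-1) ?ei ?ek;
      [field; rewrite natr1 ik1|lia].
  rewrite [nat_of_bool _]/= /cycle_res (nG 0%N) // !nB ?ei ?ek; try lia.
  by field; rewrite natr1 ik1.
have [<-|nj] := eqVneq i j.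
  by rewrite [nat_of_bool _]/= cycle_res0 /cycle_res (nG i.-1) ?(nB i.+1) ?ei -?natr1;
    [field|lia..].
rewrite [nat_of_bool _]/= /cycle_res; have [lij|lji] := ltnP i j.
  by rewrite !nG ?ei -?natr1; [field|lia..].
by rewrite !nB ?ei -?natr1; [field|lia..].
Qed.

End CycleResistance.

(** * Resistance as a sum over blocks *)

Section CactusResistance.
Variables (R : realFieldType) (V : finType) (G : sgraph V).
Implicit Types (B : {set V}) (x y z u v a b : V).
Hypotheses (conG : connected G) (cactG : is_cactus G).

(** Nothing else about resistances inside a block is used. In the last field [a] enters only through
    a delta at [a], so the difference for two choices of [a] is twice a unit potential inside the
    block, up to sign. *)
Record block_res B (r : V -> V -> R) : Prop := BlockRes {
  block_res0 : forall x, r x x = 0;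
  block_resC : forall x y, r x y = r y x;
  block_res_ge_half : {in B &, forall x y, x != y -> 1 / 2%:R <= r x y};
  block_res_sum : {in B, forall a, \sum_(y in B) r a y = res_sum R #|B|};
  block_res_laplacian : {in B &, forall x a,
    \sum_(y in B | G x y) (r x a - r y a) = 2%:R / #|B|%:R - 2%:R * (x == a)%:R} }.

Lemma block_res_exists B : is_block G B -> exists r, block_res B r.
Proof.
move=> /(cactus_block cactG)[[x [y [Gxy ->]]]|[s cB]].
  have nxy := adj_neq Gxy.
  exists (fun a b => (a != b)%:R); split=> [a|a b|a b _ _ ->|a ain|a b ain bin].
  - by rewrite eqxx.
  - by rewrite eq_sym.
  - by rewrite mulr1n; lra.
  - rewrite cards2 nxy /res_sum /= big_setU1 ?inE //= big_set1.
    by move: ain; rewrite !inE => /orP[]/eqP->; rewrite eqxx 1?[y == x]eq_sym nxy ?addr0 ?add0r.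
  rewrite cards2 nxy big_mkcondr big_setU1 ?inE //= big_set1.
  move: ain bin; rewrite !inE => /orP[]/eqP-> /orP[]/eqP->;
  rewrite ?(adj_irr, adj_sym G y x, Gxy, eqxx) 1?[y == x]eq_sym ?(negPf nxy) /=; lra.
have [k2 us eB _] := cB; have x0 : V by case: (s) k2.
have inB x : (x \in B) = (index x s < size s)%N by rewrite eB inE index_mem.
have nthB x : x \in B -> nth x0 s (index x s) = x by rewrite inB index_mem; apply: nth_index.
have cardB := card_cycle_list cB.
exists (fun a b => cycle_res R (size s) (index a s) (index b s)).
split=> [a|a b|a b aB bB nab|a aB|a b aB bB].
- exact: cycle_res0.
- exact: cycle_resC.
- apply: cycle_res_ge_half; rewrite -?inB //.
  by apply: contra nab => /eqP e; rewrite -(nthB a) // -(nthB b) // e.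
- rewrite cardB /res_sum (big_cycle_list _ x0 _ cB) gtn_eqF //.
  rewrite -(@sum_cycle_res _ _ (index a s)) -?inB //.
  by apply: eq_bigr => i _; rewrite index_uniq.
rewrite -{1 2}(nthB a) // (big_cycle_nbrs _ x0 _ cB) -?inB //=.
have ia := aB; rewrite inB in ia.
have nlt : ((if (index a s).+1 == size s then 0 else (index a s).+1) < size s)%N.
  by case: ifP => ?; lia.
have plt : ((if index a s == 0 then (size s).-1 else (index a s).-1) < size s)%N.
  by case: ifP => ?; lia.
rewrite !index_uniq //.
rewrite cycle_res_laplacian -?inB // cardB; congr (_ - _ * _%:R).
by congr nat_of_bool; apply/eqP/eqP => [e|->//]; rewrite -(nthB a) // -(nthB b) // e.
Qed.

Definition block_res_family (r : {set V} -> V -> V -> R) :=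
  forall B, is_block G B -> block_res B (r B).

Lemma block_res_family_exists : exists r, block_res_family r.
Proof.
apply: (@fin_all_exists _ _ (fun B r => is_block G B -> block_res B r)) => B.
have [/block_res_exists[r rP]|nB] := boolP (is_block G B); first by exists r.
by exists (fun _ _ => 0).
Qed.

Section Family.
Variable r : {set V} -> V -> V -> R.
Hypothesis rP : block_res_family r.

Definition block_dist u v := \sum_(B | is_block G B) r B (proj G B u) (proj G B v).

(** A block that misses [x] drops out: every edge at [x] joins two vertices with the same projection
    onto it. *)
Lemma block_dist_laplacian x u :
  \sum_(y | G x y) (block_dist x u - block_dist y u) =
  \sum_(B | is_block G B && (x \in B)) (2%:R / #|B|%:R - 2%:R * (x == proj G B u)%:R).
Proof.
under eq_bigr => y _ do rewrite /block_dist -sumrB.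
rewrite exchange_big /= [RHS]big_mkcondr /=; apply: eq_bigr => B bB.
case: (boolP (x \in B)) => xB.
  rewrite -(block_res_laplacian (rP bB)) ?proj_in // (bigID (mem B)) /= addrC big1 ?add0r.
    apply: eq_big => [y|y /andP[_ yB]]; first by rewrite andbC.
    by rewrite (proj_id conG bB xB) (proj_id conG bB yB).
  by move=> y /andP[Gxy yB]; rewrite (proj_edge conG bB Gxy) ?subrr // (negPf yB) andbF.
by apply: big1 => y Gxy; rewrite (proj_edge conG bB Gxy) ?subrr // (negPf xB).
Qed.

(** In a connected network the potential of a unit current from u to v is (R(x,v) - R(x,u))/2 up to
    a constant. Putting [block_dist] for R gives a candidate, which is checked against
    [unit_potential]. *)
Lemma resistance_blocks u v : resistance R G u v = block_dist u v.
Proof.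
have b0 w : block_dist w w = 0.
  by apply: big1 => B bB; rewrite (block_res0 (rP bB)).
have bC : block_dist u v = block_dist v u.
  by apply: eq_bigr => B bB; rewrite (block_resC (rP bB)).
rewrite (resistanceP (phi := fun x => (block_dist x v - block_dist x u) / 2%:R)) //.
  by rewrite !b0 -bC; field.
move=> x; transitivity ((\sum_(y | G x y) (block_dist x v - block_dist y v) -
    \sum_(y | G x y) (block_dist x u - block_dist y u)) / 2%:R).
  by rewrite -[in RHS]sumrB [RHS]mulr_suml; apply: eq_bigr => y _; lra.
(* For w other than [x], all blocks at [x] but one project w to [x]. The number of blocks at [x]
   cancels between [u] and [v]. *)
have sep w : \sum_(B | is_block G B && (x \in B)) (x == proj G B w)%:R =
   \sum_(B | is_block G B && (x \in B)) 1 - 1 + (x == w)%:R :> R.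
  have : \sum_(B | is_block G B && (x \in B)) (proj G B w != x)%:R = (x != w)%:R :> R.
    by rewrite -natr_sum (card_separating_blocks conG) eq_sym.
  have -> : (x == w)%:R = 1 - (x != w)%:R :> R by case: (x == w) => /=; lra.
  move=> <-; rewrite addrA subrK -sumrB; apply: eq_bigr => B _.
  by rewrite eq_sym; case: (_ == _) => /=; lra.
rewrite !block_dist_laplacian !sumrB -!mulr_sumr !sep; lra.
Qed.

(** Splitting d(u) + d(v) turns unordered pairs into ordered pairs weighted by the degree of the
    first, hence the asymmetric product of [fibD] and [fibN] in [contrib]. *)
Lemma DR_sum : DR R G = \sum_u \sum_v (deg G u)%:R * block_dist u v.
Proof.
have bC u v : block_dist u v = block_dist v u.
  by apply: eq_bigr => B bB; rewrite (block_resC (rP bB)).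
have b0 w : block_dist w w = 0.
  by apply: big1 => B bB; rewrite (block_res0 (rP bB)).
rewrite /DR; transitivity (\sum_u \sum_(v | (enum_rank u < enum_rank v)%N)
    (deg G u)%:R * block_dist u v +
  \sum_u \sum_(v | (enum_rank u < enum_rank v)%N) (deg G v)%:R * block_dist u v).
  rewrite -big_split /=; apply: eq_bigr => u _; rewrite -big_split /=.
  by apply: eq_bigr => v _; rewrite resistance_blocks natrD mulrDl.
rewrite [X in _ + X](exchange_big_dep xpredT) //= -big_split /=.
apply: eq_bigr => u _; rewrite [RHS](bigID (fun v => enum_rank u < enum_rank v)%N) /=.
congr (_ + _); rewrite [RHS](bigD1 u) ?ltnn //= b0 mulr0 add0r.
apply: eq_big => [v|v _]; last by rewrite bC.
by rewrite -leqNgt ltn_neqAle (inj_eq val_inj) (inj_eq enum_rank_inj) andbC.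
Qed.

Definition contrib B :=
  \sum_(a in B) \sum_(b in B) r B a b * (fibD G B a)%:R * (fibN G B b)%:R.

Lemma DR_blocks : DR R G = \sum_(B | is_block G B) contrib B.
Proof.
rewrite DR_sum.
under eq_bigr => u _.
  under eq_bigr => v _ do rewrite /block_dist mulr_sumr.
  rewrite exchange_big /=.
  over.
rewrite exchange_big /=; apply: eq_bigr => B bB.
rewrite (partition_big (proj G B) (mem B)) /=; last by move=> u _; apply: proj_in.
apply: eq_bigr => a aB.
under eq_bigr => u _.
  rewrite (partition_big (proj G B) (mem B)) /=; last by move=> v _; apply: proj_in.
  over.
rewrite exchange_big /=; apply: eq_bigr => b bB'.
rewrite /fibD natr_sum mulr_sumr mulr_suml; apply: eq_bigr => u /eqP eu.
rewrite (eq_bigr (fun=> r B a b * (deg G u)%:R)); last first.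
  by move=> v /eqP ev; rewrite eu ev mulrC.
by rewrite sumr_const -[LHS]mulr_natr; congr (_ * _%:R); rewrite /fibN cardsE.
Qed.

End Family.
End CactusResistance.

(** * Excess of a block over the bouquet *)

Section BaseValues.
Variables (R : realFieldType) (n t : nat).

(* The contribution of a block that is a pendent edge, resp. a triangle with at most one
   nontrivial fiber. *)
Definition edge_base : R := 3%:R * n%:R - 4%:R + 2%:R * t%:R.
Definition triangle_base : R := (16%:R * n%:R + 8%:R * t%:R - 32%:R) / 3%:R.
(** The value of n - 1 - 2t pendent edges together with t triangles. *)
Definition DR_min : R :=
  (n%:R - 1) * edge_base + t%:R * (triangle_base - 2%:R * edge_base).
Definition gap : R := (5%:R * n%:R + t%:R - 31%:R) / 3%:R.

(* What the vertices of a k-block would contribute as k-1 pendent edges, resp. as a triangle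
   and k-3 pendent edges. *)
Definition base (k : nat) : R :=
  (k%:R - 1) * edge_base + (2 < k)%N%:R * (triangle_base - 2%:R * edge_base).

(** What is left of [contrib] without [cross]. With d the degree inside the block, the last factor
    is d n plus the total degree 2(n-1) + 2t minus d k. *)
Definition contrib_min (k : nat) : R :=
  res_sum R k * ((1 + (2 < k)%N)%:R * (n%:R - k%:R) + 2%:R * (n%:R - 1) + 2%:R * t%:R).

Lemma contrib_min2 : contrib_min 2 = base 2.
Proof. by rewrite /contrib_min /base /edge_base /res_sum /=; ring. Qed.

Lemma contrib_min3 : contrib_min 3 = base 3.
Proof. by rewrite /contrib_min /base /edge_base /triangle_base /res_sum /=; field. Qed.

Lemma contrib_min4 : contrib_min 4 = base 4 + gap.
Proof. by rewrite /contrib_min /base /edge_base /triangle_base /gap /res_sum /=; field. Qed.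

(** With n = k + s and t = w + 1, three times the difference is (2k-1)(k-4)s + (k-2)(k-4)w + k^3 -
    9k^2 + 11k + 36. The part free of s and w is positive from k = 7 on; at k = 5 and 6 it is -9 and
    -6, and n >= 7 forces s >= 2 and s >= 1, which compensates. *)
Lemma contrib_min_ge5 k : (7 <= n)%N -> (1 <= t)%N -> (5 <= k <= n)%N ->
  base k + gap < contrib_min k.
Proof.
move=> n7 t1 /andP[k5 kn].
have [s es] : exists s, n = (k + s)%N by exists (n - k)%N; lia.
have [w ew] : exists w, t = w.+1 by exists t.-1; lia.
have s0 : 0 <= s%:R :> R := ler0n R s.
have w0 : 0 <= w%:R :> R := ler0n R w.
rewrite /contrib_min /base /edge_base /triangle_base /gap /res_sum.
have k2 : (2 < k)%N by lia.
have k2' : (k == 2%N) = false by lia.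
rewrite k2 k2'.
rewrite [nat_of_bool _]/= -subr_gt0.
have -> : t%:R = w%:R + 1 :> R by rewrite ew natr1.
have En : n%:R = k%:R + s%:R :> R by rewrite es natrD.
rewrite En.
have [k7|k7] := leqP 7 k.
  have [j ej] : exists j, k = (7 + j)%N by exists (k - 7)%N; lia.
  have j0 : 0 <= j%:R :> R := ler0n R j.
  have -> : k%:R = 7%:R + j%:R :> R by rewrite ej natrD.
  move: (s%:R) (w%:R) (j%:R) s0 w0 j0 => S W J s0 w0 j0.
  have h1 := mulr_ge0 s0 j0. have h2 := mulr_ge0 w0 j0.
  have h3 := mulr_ge0 j0 j0. have h4 := mulr_ge0 s0 h3.
  have h5 := mulr_ge0 w0 h3. have h6 := mulr_ge0 j0 h3.
  rewrite expr2; lra.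
have [ek|nk5] := eqVneq k 5.
  have s2 : 2%:R <= s%:R :> R by rewrite ler_nat; lia.
  by rewrite ek; lra.
have ek : k = 6%N by lia.
have s1 : 1 <= s%:R :> R by rewrite ler1n; lia.
by rewrite ek; lra.
Qed.

Lemma gap_gt0 : (7 <= n)%N -> (1 <= t)%N -> 0 < gap.
Proof.
move=> n7 t1; rewrite /gap.
have h1 : 7%:R <= n%:R :> R by rewrite ler_nat.
have h2 : 1 <= t%:R :> R by rewrite ler1n.
lra.
Qed.

End BaseValues.

Section Excess.
Variables (R : realFieldType) (V : finType) (G : sgraph V).
Implicit Types (A B : {set V}) (x y z u v a b c : V).
Hypotheses (conG : connected G) (cactG : is_cactus G).
Local Notation n := #|V|.
Local Notation t := #|cycles G|.
Variable r : {set V} -> V -> V -> R.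
Hypothesis rP : block_res_family G r.

(** [extraN] and [extraD] measure what the fiber adds to the vertex [a] with its degree inside [B].
    By [fiber_bounds] the truncated subtractions lose nothing when [B] is a block. *)
Definition extraN B a := (fibN G B a).-1.
Definition extraD B a := (fibD G B a - (1 + (2 < #|B|)))%N.

Definition cross B := \sum_(a in B) \sum_(b in B)
  r B a b * (extraD B a)%:R * (extraN B b)%:R.

Lemma bdeg_block B a : is_block G B -> a \in B -> bdeg G B a = (1 + (2 < #|B|))%N.
Proof.
move=> /(cactus_block cactG)[[x [y [Gxy ->]]]|[s cB]] aB.
  by rewrite bdeg_edge // cards2 (adj_neq Gxy).
by rewrite (bdeg_cycle cB) // (card_cycle_list cB); case: cB => ->.
Qed.

Lemma fiber_bounds B a : is_block G B -> a \in B ->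
  [/\ fibN G B a = (extraN B a).+1, fibD G B a = (extraD B a + (1 + (2 < #|B|)))%N,
      (2 * extraN B a <= extraD B a)%N & (extraD B a <= 4 * extraN B a)%N].
Proof.
move=> bB aB; have := fibN_gt0 conG bB aB.
have : forall B', is_block G B' ->
     (2 * #|B'|.-1 <= \sum_(x in B') bdeg G B' x <= 4 * #|B'|.-1)%N.
  move=> B' bB'; rewrite sum_bdeg //; have := block_card_gt1 cactG bB'.
  by case: (2 < #|B'|)%N; lia.
move/(fibD_bounds conG bB aB); rewrite bdeg_block // /extraN /extraD.
by move=> /andP[h1 h2] h3; split; lia.
Qed.

Lemma sum_extraN B : is_block G B -> (\sum_(a in B) extraN B a = n - #|B|)%N.
Proof.
move=> bB; rewrite -(sum_fibN conG bB) -sum1_card -sumnB.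
  by apply: eq_bigr => a aB; rewrite subn1.
by move=> a aB; apply: fibN_gt0.
Qed.

Lemma sum_extraD B : is_block G B ->
  (\sum_(a in B) extraD B a + (1 + (2 < #|B|)) * #|B| = 2%N * n.-1 + 2 * t)%N.
Proof.
move=> bB; have /card_gt0P[u _] : (0 < #|B|)%N by apply: ltnW (block_card_gt1 cactG bB).
rewrite -(sum_deg_cactus conG cactG u) -(sum_fibD conG bB) mulnC -sum_nat_const -big_split /=.
by apply: eq_bigr => a aB; have [_ -> _ _] := fiber_bounds bB aB.
Qed.

Lemma contribE B : is_block G B -> contrib G r B = contrib_min R n t #|B| + cross B.
Proof.
move=> bB; have rB := rP bB; set d := (1 + (2 < #|B|))%N.
have V0 : (0 < n)%N.
  by apply: leq_trans (max_card B); apply: ltnW (block_card_gt1 cactG bB).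
have colsum b : b \in B -> \sum_(a in B) r B a b = res_sum R #|B|.
  move=> bB'; rewrite -(block_res_sum rB bB'); apply: eq_bigr => a _.
  exact: block_resC rB _ _.
transitivity (d%:R * \sum_(a in B) \sum_(b in B) r B a b * (fibN G B b)%:R +
   \sum_(a in B) (extraD B a)%:R * (\sum_(b in B) r B a b) + cross B).
  rewrite mulr_sumr -!big_split /=; apply: eq_bigr => a aB.
  have [_ eD _ _] := fiber_bounds bB aB.
  rewrite !mulr_sumr -!big_split /=; apply: eq_bigr => b b0.
  have [eN _ _ _] := fiber_bounds bB b0.
  by rewrite eD eN -[(extraN B b).+1]addn1 !natrD; ring.
congr (_ + _); rewrite exchange_big /=.
under eq_bigr => b b0 do rewrite -mulr_suml colsum // mulrC.
rewrite -mulr_suml -natr_sum (sum_fibN conG bB).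
under eq_bigr => a aB do rewrite (block_res_sum rB aB).
rewrite -mulr_suml -natr_sum /contrib_min -/d.
have := sum_extraD bB; rewrite -/d => /(congr1 (fun m => m%:R : R)).
rewrite natrD [X in _ + X = _]natrM [X in _ = X]natrD !(natrM R 2) -subn1 natrB // => eE.
have -> : (\sum_(a in B) extraD B a)%:R = 2%:R * (n%:R - 1) + 2%:R * t%:R - d%:R * #|B|%:R :> R.
  by rewrite -eE; ring.
ring.
Qed.

Lemma block_res_ge0 B a b : is_block G B -> a \in B -> b \in B -> 0 <= r B a b.
Proof.
move=> bB aB b0; have [->|nab] := eqVneq a b; first by rewrite (block_res0 (rP bB)).
by apply: le_trans (block_res_ge_half (rP bB) aB b0 nab); lra.
Qed.

Lemma cross_ge0 B : is_block G B -> 0 <= cross B.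
Proof.
move=> bB; apply: sumr_ge0 => a aB; apply: sumr_ge0 => b b0.
by rewrite !mulr_ge0 ?ler0n // block_res_ge0.
Qed.

(** Off the diagonal one of the two vertices is not the center; its [extraN] vanishes, and so does
    its [extraD]. This is the purpose of the upper bound in [fiber_bounds]. *)
Lemma cross_concentrated B : is_block G B -> concentrated G B -> cross B = 0.
Proof.
move=> bB /exists_inP[c cB /forall_inP h]; apply: big1 => a aB; apply: big1 => b b0.
have z x : x \in B -> x != c -> extraN B x = 0%N.
  by move=> xB nx; have /implyP/(_ nx)/eqP := h x xB; rewrite /extraN => ->.
have [ebc|nbc] := eqVneq b c; last by rewrite z // mulr0.
have [eac|nac] := eqVneq a c; first by rewrite eac ebc (block_res0 (rP bB)) !mul0r.
have [_ _ _] := fiber_bounds bB aB; rewrite z // muln0 leqn0 => /eqP->.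
by rewrite mulr0 mul0r.
Qed.

Lemma not_concentrated B : is_block G B -> ~~ concentrated G B ->
  exists a b, [/\ a \in B, b \in B, a != b, (0 < extraN B a)%N & (0 < extraN B b)%N].
Proof.
move=> bB; rewrite negb_exists_in => /forall_inP h.
have find c : c \in B -> exists2 a, a \in B & (a != c) && (0 < extraN B a)%N.
  move=> /h; rewrite negb_forall_in => /exists_inP[a aB].
  rewrite negb_imply => /andP[nac n1]; exists a; rewrite // nac /=.
  by have := fibN_gt0 conG bB aB; rewrite /extraN; move: n1; lia.
have /card_gt0P[c cB] : (0 < #|B|)%N by apply: ltnW (block_card_gt1 cactG bB).
(* Any [c] yields one vertex with a nontrivial fiber; that vertex, tried as a center, yields a
   second. *)
have [a aB /andP[_ ea]] := find c cB.
have [b b0 /andP[nb eb]] := find a aB.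
by exists b, a.
Qed.

(** Let p and q be the sums of [extraN] at [a] and away from [a]. The pairs with exactly one entry
    [a] contribute at least 2pq, and pq >= p + q - 1 because p and q are positive, while p + q = n -
    |B|. *)
Lemma cross_not_concentrated B : is_block G B -> ~~ concentrated G B ->
  2%:R * (n%:R - #|B|%:R - 1) <= cross B.
Proof.
move=> bB /(not_concentrated bB)[a [b [aB b0 nab pa pb]]].
have rB := rP bB.
pose F x y := r B x y * (extraD B x)%:R * (extraN B y)%:R.
have F0 x y : x \in B -> y \in B -> 0 <= F x y.
  by move=> xB yB; rewrite !mulr_ge0 ?ler0n // block_res_ge0.
have Fge x y : x \in B -> y \in B -> x != y -> (extraN B x)%:R * (extraN B y)%:R <= F x y.
  move=> xB yB nxy; rewrite /F ler_wpM2r ?ler0n //.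
  have [_ _ le2 _] := fiber_bounds bB xB.
  have : (2 * extraN B x)%:R <= (extraD B x)%:R :> R by rewrite ler_nat.
  rewrite natrM => l2; have l1 := block_res_ge_half rB xB yB nxy.
  apply: le_trans (ler_pM _ _ l1 l2); [lra | lra |].
  by rewrite mulr_ge0 ?ler0n.
set P' := (\sum_(x in B | x != a) extraN B x)%N.
have eP : (extraN B a + P' = n - #|B|)%N.
  by rewrite -sum_extraN // (bigD1 a).
have P'1 : (1 <= P')%N by rewrite /P' (bigD1 b) /= ?b0 1?eq_sym // addn_gt0 pb.
have low : (extraN B a)%:R * P'%:R + (extraN B a)%:R * P'%:R <= cross B.
  rewrite /cross (bigD1 a) //=; apply: lerD.
    rewrite (bigD1 a) //= -[X in X <= _]add0r; apply: lerD; first exact: F0.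
    rewrite natr_sum mulr_sumr; apply: ler_sum => y /andP[yB ny].
    by apply: Fge => //; rewrite eq_sym.
  rewrite natr_sum mulr_sumr; apply: ler_sum => x /andP[xB nx].
  rewrite (bigD1 a) //= -[X in X <= _]addr0; apply: lerD.
    by rewrite mulrC; apply: Fge.
  by apply: sumr_ge0 => y /andP[yB _]; apply: F0.
apply: le_trans low.
have -> : n%:R - #|B|%:R = (extraN B a)%:R + P'%:R :> R.
  by rewrite -natrD eP natrB // max_card.
have p1 : 1 <= (extraN B a)%:R :> R by rewrite ler1n.
have p2 : 1 <= P'%:R :> R by rewrite ler1n.
have := mulr_ge0 (_ : 0 <= (extraN B a)%:R - 1 :> R) (_ : 0 <= P'%:R - 1 :> R).
rewrite !subr_ge0 => /(_ p1 p2); lra.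
Qed.

Definition excess B := contrib G r B - base R n t #|B|.

(** The two coefficients in [base] add up over the blocks to n - 1 and t, so cacti with the same n
    and t share the same total of [base]. *)
Lemma DR_excess : (0 < n)%N ->
  DR R G = DR_min R n t + \sum_(B | is_block G B) excess B.
Proof.
move=> /card_gt0P[u _]; rewrite (DR_blocks conG rP) sumrB.
suff -> : \sum_(B | is_block G B) base R n t #|B| = DR_min R n t by rewrite addrC subrK.
rewrite /base big_split /= -!mulr_suml; congr (_ * _ + _ * _).
  have V0 : (0 < n)%N by apply/card_gt0P; exists u.
  transitivity ((\sum_(B | is_block G B) #|B|.-1)%N%:R : R); last first.
    by rewrite (sum_blocks_card conG u) -subn1 natrB.
  rewrite natr_sum; apply: eq_bigr => B bB.
  by rewrite -subn1 natrB // ltnW // (block_card_gt1 cactG bB).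
rewrite -natr_sum card_cycles // card_set_sum big_mkcond; congr (_%:R).
by apply: eq_bigr => B _; case: (is_block G B).
Qed.

Hypotheses (n7 : (7 <= n)%N) (t1 : (1 <= t)%N).
Local Notation gapG := (gap R n t).

Lemma excess_small B : is_block G B -> (#|B| <= 3)%N -> excess B = cross B.
Proof.
move=> bB k3; have := block_card_gt1 cactG bB; rewrite /excess contribE //.
have [->|nk] := eqVneq #|B| 2%N; first by rewrite contrib_min2 addrAC subrr add0r.
move=> k2; have k3' : #|B| = 3%N by lia.
by rewrite k3' contrib_min3 addrAC subrr add0r.
Qed.

Lemma excess4 B : is_block G B -> #|B| = 4%N -> excess B = gapG + cross B.
Proof. by move=> bB k4; rewrite /excess contribE // k4 contrib_min4; ring. Qed.

Lemma excess_ge5 B : is_block G B -> (5 <= #|B|)%N -> gapG < excess B.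
Proof.
move=> bB k5; rewrite /excess contribE //; have := cross_ge0 bB.
have := @contrib_min_ge5 R n t #|B| n7 t1; rewrite k5 max_card => /(_ isT); lra.
Qed.

Lemma excess_ge0 B : is_block G B -> 0 <= excess B.
Proof.
move=> bB; have := cross_ge0 bB; have g0 := gap_gt0 R n7 t1.
have [k3|k3] := leqP #|B| 3; first by rewrite excess_small.
have [k5|k5] := leqP 5 #|B|; first by have := excess_ge5 bB k5; lra.
by rewrite excess4 //; [lra | lia].
Qed.

Lemma DR_concentrated : (forall B, is_block G B -> concentrated G B /\ (#|B| <= 3)%N) ->
  DR R G = DR_min R n t.
Proof.
move=> h; rewrite DR_excess; last by lia.
rewrite big1 ?addr0 // => B bB; have [cB k3] := h B bB.
by rewrite excess_small // cross_concentrated.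
Qed.

Lemma DR_concentrated4 B4 : is_block G B4 -> #|B4| = 4%N -> concentrated G B4 ->
  (forall B, is_block G B -> B != B4 -> concentrated G B /\ (#|B| <= 3)%N) ->
  DR R G = DR_min R n t + gapG.
Proof.
move=> b4 k4 c4 h; rewrite DR_excess; last by lia.
rewrite (bigD1 B4) //= big1 ?addr0 => [|B /andP[bB nB]].
  by rewrite excess4 // cross_concentrated // addr0.
have [cB k3] := h B bB nB.
by rewrite excess_small // cross_concentrated.
Qed.

Hypothesis nt : (2 * t + 2 <= n)%N.

Lemma excess_le_gap B : is_block G B -> excess B <= gapG ->
  concentrated G B /\ (#|B| <= 4)%N.
Proof.
move=> bB hB.
have k4 : (#|B| <= 4)%N.
  by rewrite leqNgt; apply/negP=> /(excess_ge5 bB); lra.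
split=> //; apply: contraLR hB => /(cross_not_concentrated bB).
have hn : 7%:R <= n%:R :> R by rewrite ler_nat.
have ht : 2%:R * t%:R + 2%:R <= n%:R :> R by rewrite -natrM -natrD ler_nat.
(* For at most three vertices [cross] is at least 2(n-4), above the gap because t < n + 7. A 4-cycle
   has already spent the gap, so any positive [cross] is too much. *)
rewrite -ltNge; have [k3|k3] := leqP #|B| 3.
  rewrite excess_small //; have : #|B|%:R <= 3%:R :> R by rewrite ler_nat.
  by rewrite /gap; lra.
have -> : #|B| = 4%N by lia.
by rewrite excess4; [lra | | lia].
Qed.

Lemma DR_le_gap : DR R G <= DR_min R n t + gapG ->
  (forall B, is_block G B -> concentrated G B /\ (#|B| <= 4)%N) /\
  (forall B B', is_block G B -> is_block G B' -> #|B| = 4%N -> #|B'| = 4%N -> B = B').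
Proof.
rewrite DR_excess; last by lia.
rewrite lerD2l => le_gap; split=> [B bB|B B' bB bB' k k'].
  apply: excess_le_gap => //; apply: le_trans le_gap.
  rewrite (bigD1 B) //= lerDl; apply: sumr_ge0 => B' /andP[bB' _].
  exact: excess_ge0.
apply: contraTeq le_gap => nB; rewrite -ltNge.
rewrite (bigD1 B) //= (bigD1 B') /= ?bB' 1?eq_sym // !excess4 //.
have := cross_ge0 bB; have := cross_ge0 bB'; have g0 := gap_gt0 R n7 t1.
have : 0 <= \sum_(i | is_block G i && (i != B) && (i != B')) excess i.
  by apply: sumr_ge0 => C /andP[/andP[bC _] _]; apply: excess_ge0.
lra.
Qed.

End Excess.

(** * Values at G0 and G5, and the conclusion *)

Lemma cycles_of_sum_deg (V : finType) (G : sgraph V) n t : #|V| = n -> (0 < n)%N ->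
  connected G -> is_cactus G -> (\sum_v deg G v = 2 * n.-1 + 2 * t)%N -> #|cycles G| = t.
Proof.
move=> Vn n0 conG cactG; have /card_gt0P[u _] : (0 < #|V|)%N by rewrite Vn.
rewrite (sum_deg_cactus conG cactG u) Vn; lia.
Qed.

Lemma G0_Cact n t : (1 < n)%N -> (t.*2 < n)%N -> Cact (G0 n t) n t.
Proof.
move=> n1 tn; have pG := G0_petal_graph (ltnW n1) tn.
have conG := petal_connected pG.
have cactG : is_cactus (G0 n t) by apply: (petal_cactus pG); rewrite card_ord.
split=> //; first exact: card_ord.
by apply: cycles_of_sum_deg (sum_deg_G0 tn) => //; rewrite ?card_ord // ltnW.
Qed.

Lemma G5_Cact n t : (3 < n)%N -> (0 < t)%N -> (t.*2.+1 < n)%N -> Cact (G5 n t) n t.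
Proof.
move=> n3 t0 tn; have [S [pG _ _]] := G5_petal_graph n3 t0 tn.
have conG := petal_connected pG.
have n1 : (1 < n)%N := leq_trans (isT : 1 < 4)%N n3.
have cactG : is_cactus (G5 n t) by apply: (petal_cactus pG); rewrite card_ord.
split=> //; first exact: card_ord.
by apply: cycles_of_sum_deg (sum_deg_G5 t0 tn) => //; rewrite ?card_ord // ltnW.
Qed.

Lemma DR_G0 (R : realFieldType) n t : (7 <= n)%N -> (1 <= t)%N -> (2 * t + 2 <= n)%N ->
  DR R (G0 n t) = DR_min R n t.
Proof.
move=> n7 t1 nt; have tn : (t.*2 < n)%N by lia.
have n1 : (1 < n)%N by lia.
have pG := G0_petal_graph (ltnW n1) tn; have [eV conG cactG et] := G0_Cact n1 tn.
have [r rP] := block_res_family_exists R conG cactG.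
have := DR_concentrated conG cactG rP; rewrite eV et; apply=> // B bB.
have V1 : (1 < #|'I_n|)%N by rewrite card_ord.
split.
  by apply: (center_concentrated conG) bB => B'; apply: (petal_center_block pG).
apply: (petal_card pG V1 bB).
(* With [S] empty the excluded set is the center alone, too small to be a block. *)
by apply: contraTneq (block_card_gt1 cactG bB) => ->; rewrite setU0 cards1.
Qed.

Lemma DR_G5 (R : realFieldType) n t : (7 <= n)%N -> (1 <= t)%N -> (2 * t + 2 <= n)%N ->
  DR R (G5 n t) = DR_min R n t + gap R n t.
Proof.
move=> n7 t1 nt; have tn : (t.*2.+1 < n)%N by lia.
have n3 : (3 < n)%N by lia.
have [S [pG /set0Pn[x xS] e4]] := G5_petal_graph n3 t1 tn.
have [eV conG cactG et] := G5_Cact n3 t1 tn.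
have [r rP] := block_res_family_exists R conG cactG.
have V1 : (1 < #|'I_n|)%N by rewrite card_ord; lia.
have conc B : is_block (G5 n t) B -> concentrated (G5 n t) B.
  by move=> bB; apply: (center_concentrated conG) bB => B'; apply: (petal_center_block pG).
have bS := special_block pG V1 xS.
have := DR_concentrated4 conG cactG rP; rewrite eV et.
move=> /(_ n7 t1 _ bS e4 (conc _ bS)); apply=> B bB nB; split; first exact: conc.
exact: (petal_card pG V1 bB nB).
Qed.

(** [hG5] is the room needed by a 4-cycle and t - 1 triangles at a common vertex: 4 + 2(t-1) <=
    n. *)
Theorem theorem4p1 (R : realFieldType) (n t : nat)
    (hn : (7 <= n)%N) (ht : (1 <= t)%N) (hG5 : (2 * t + 2 <= n)%N) :
  [/\ Cact (G0 n t) n t,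
      Cact (G5 n t) n t,
      DR R (G0 n t) < DR R (G5 n t) &
      forall (V : finType) (G : sgraph V), Cact G n t ->
        ~ isomorphic G (G0 n t) -> ~ isomorphic G (G5 n t) ->
        DR R (G5 n t) < DR R G].
Proof.
have tn : (t.*2.+1 < n)%N by lia.
split.
- by apply: G0_Cact; lia.
- by apply: G5_Cact; lia.
- by rewrite DR_G0 // DR_G5 // ltrDl gap_gt0.
move=> V G [Vn conG cactG et] nG0 nG5; rewrite DR_G5 // ltNge; apply/negP=> DRle.
have [r rP] := block_res_family_exists R conG cactG.
have n7 : (7 <= #|V|)%N by rewrite Vn.
have V1 : (1 < #|V|)%N by apply: leq_trans n7.
have /card_gt0P[u _] : (0 < #|V|)%N by apply: leq_trans n7.
have := sum_deg_cactus conG cactG u; rewrite Vn et => degG.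
have [hB uniq4] : (forall B, is_block G B -> concentrated G B /\ (#|B| <= 4)%N) /\
  (forall B B', is_block G B -> is_block G B' -> #|B| = 4%N -> #|B'| = 4%N -> B = B').
  by apply: (@DR_le_gap R _ _ conG cactG r rP); rewrite ?Vn ?et.
have [c hc] := concentrated_center conG cactG n7 hB.
have hcB B : is_block G B -> c \in B /\ (#|B| <= 4)%N.
  by move=> bB; split; [apply: hc | case: (hB B bB)].
have [/petal_graph_G0|[B [bB e4]]] := center_petal_graph conG cactG V1 hcB uniq4.
  (* Recognition yields some number [p] of triangles; the degree sum, an isomorphism invariant,
     forces p = t. *)
  rewrite Vn => -[p pn isoG]; apply: nG0; suff <- : p = t by [].
  have := sum_deg_iso isoG; rewrite degG sum_deg_G0 //; lia.
move/(petal_graph_G5 cactG bB e4 (hc B bB)); rewrite Vn => -[p [p0 pn isoG]].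
apply: nG5; suff <- : p = t by [].
have := sum_deg_iso isoG; rewrite degG sum_deg_G5 //; lia.
Qed.
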